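(* For every $d<\infty$ there exists a constant $C_d<\infty$, depending only on $d$, such that the following holds. Let $G=(V,E)$ be a connected, possibly infinite, simple graph with non-negative Ollivier--Ricci curvature and with all vertex degrees bounded by $d$. Then for every $x\in V$ and all real $r,t\ge e^e$, \[ \mathbb E_x\,\mathrm{dist}(x,X_t)^2\le t\exp\left[C_d\sqrt{\log (t)\,\log\log (t)}\right], \] \[ \mathcal H_t(x)\le \exp\left[C_d\sqrt{\log (t)\,\log\log (t)}\right], \] \[ \log\mathrm{Vol}(B(x,r))\le \exp\left[C_d\sqrt{\log (r)\,\log\log (r)}\right]. \]
   Context: $G=(V,E)$ is a connected, locally finite, simple graph with at least one edge. Its random walk kernel is $P(x,y)=\mathbf 1_{\{x\sim y\}}/\deg(x)$, and $m(x)=\deg(x)$. $\mathrm{dist}$ is the graph distance, $B(x,r)=\{y\in V:\mathrm{dist}(x,y)\le r\}$, and $\mathrm{Vol}(A)=\sum_{z\in A}m(z)$ for $A\subseteq V$. For probability measures $\mu,\nu$ on $V$, $W_1(\mu,\nu)=\inf_\pi\sum_{u,v\in V}\mathrm{dist}(u,v)\pi(u,v)$, the infimum being over all couplings $\pi$ of $\mu$ and $\nu$. With the lazy kernel $\widehat P=\frac12(I+P)$, $G$ has non-negative Ollivier--Ricci curvature if $W_1(\widehat P(x,\cdot),\widehat P(y,\cdot))\le 1$ whenever $x\sim y$. $(X_t)_{t\ge0}$ is the continuous-time random walk on $V$ with generator $L=P-I$, so that $\mathbb P_x(X_t=y)=P_t(x,y)=e^{-t}\sum_{k\ge0}\frac{t^k}{k!}P^k(x,y)$;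 $\mathbb E_x$ is expectation for the walk started at $X_0=x$. The heat entropy is $\mathcal H_t(x)=-\sum_{z\in V}P_t(x,z)\log\frac{P_t(x,z)}{m(z)}$ (with $0\log 0=0$). *)

(* Defs.v *)
From HB Require Import structures.
From mathcomp Require Import all_boot all_order all_algebra finmap.
From mathcomp Require Import all_classical all_reals all_analysis.

Set Implicit Arguments.
Unset Strict Implicit.
Unset Printing Implicit Defensive.

Import Order.TTheory GRing.Theory Num.Theory.
Import numFieldNormedType.Exports.

Local Open Scope classical_set_scope.
Local Open Scope ring_scope.

(* A simple graph with vertex set V is a symmetric and irreflexive relation
   e : rel V. *)

Definition neighbors (V : choiceType) (e : rel V) (x : V) : set V :=
  [set y | e x y].

Definition locally_finite_graph (V : choiceType) (e : rel V) : Prop :=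
  forall x, finite_set (neighbors e x).

(* Meaningful when neighbors e x is finite: fset_set is empty on infinite
   sets. *)
Definition deg (V : choiceType) (e : rel V) (x : V) : nat :=
  #|` fset_set (neighbors e x)|.

Definition has_walk (V : choiceType) (e : rel V) (x y : V) (n : nat) : Prop :=
  exists p : seq V, [/\ path e x p, last x p = y & size p = n].

Definition connected_graph (V : choiceType) (e : rel V) : Prop :=
  forall x y, exists n, has_walk e x y n.

(* 0 by convention if y is not reachable from x. *)
Definition dist (V : choiceType) (e : rel V) (x y : V) : nat :=
  match pselect (exists n, `[< has_walk e x y n >]) with
  | left h => ex_minn h
  | right _ => 0%N
  end.

Definition gball (R : realType) (V : choiceType) (e : rel V) (x : V) (r : R)
  : set V := [set y | (dist e x y)%:R <= r].

Definition vol (R : realType) (V : choiceType) (e : rel V) (A : set V)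
  : \bar R := \esum_(z in A) ((deg e z)%:R)%:E.

(* Kernels on V are functions V -> V -> R. *)

Definition idk (R : realType) (V : choiceType) (x y : V) : R := (x == y)%:R.

Definition rw_kernel (R : realType) (V : choiceType) (e : rel V) (x y : V)
  : R := (e x y)%:R / (deg e x)%:R.

Definition lazy_kernel (R : realType) (V : choiceType) (e : rel V) (x y : V)
  : R := 2^-1 * (idk R x y + rw_kernel R e x y).

(* The sum over all z is a sum with finite support when e is locally finite. *)
Fixpoint rw_kernel_pow (R : realType) (V : choiceType) (e : rel V) (k : nat)
    (x y : V) : R :=
  if k is k'.+1 then
    \sum_(z \in [set: V]) rw_kernel R e x z * rw_kernel_pow R e k' z y
  else idk R x y.

Definition heat_kernel (R : realType) (V : choiceType) (e : rel V) (t : R)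
    (x y : V) : R :=
  expR (- t) *
  limn (series (fun k => t ^+ k / k`!%:R * rw_kernel_pow R e k x y)).

(* Probability measures on V are given by their mass functions V -> R. *)

Definition coupling (R : realType) (V : choiceType) (mu nu : V -> R)
    (pi : V * V -> R) : Prop :=
  [/\ forall uv, 0 <= pi uv,
      forall u, (\esum_(v in [set: V]) (pi (u, v))%:E = (mu u)%:E)%E &
      forall v, (\esum_(u in [set: V]) (pi (u, v))%:E = (nu v)%:E)%E].

Definition W1 (R : realType) (V : choiceType) (e : rel V) (mu nu : V -> R)
  : \bar R :=
  ereal_inf [set (\esum_(uv in [set: V * V])
                    ((dist e uv.1 uv.2)%:R * pi uv)%:E)%E
            | pi in coupling mu nu].

Definition nonneg_ollivier_ricci (R : realType) (V : choiceType) (e : rel V)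
  : Prop :=
  forall x y, e x y -> (W1 e (lazy_kernel R e x) (lazy_kernel R e y) <= 1)%E.

(* path_prob e s x [:: (t1, y1); ...; (tn, yn)] is
   P_{t1-s}(x, y1) P_{t2-t1}(y1, y2) ... P_{tn-t(n-1)}(y(n-1), yn). *)
Fixpoint path_prob (R : realType) (V : choiceType) (e : rel V) (s : R) (x : V)
    (l : seq (R * V)) : R :=
  if l is (t, y) :: l' then heat_kernel e (t - s) x y * path_prob e t y l'
  else 1.

(* (X t)_{t >= 0} is a Markov process on V (with its discrete sigma-algebra)
   with transition semigroup heat_kernel, the semigroup generated by
   L = P - I, started at x.  Taking the time 0 in the finite-dimensional
   distributions gives X 0 = x almost surely.  Path regularity is not
   required; negative times are irrelevant. *)
Definition random_walk_from (R : realType) (V : choiceType) (e : rel V) (x : V)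
    (dO : measure_display) (O : measurableType dO) (Pr : probability O R)
    (X : R -> O -> V) : Prop :=
  (forall (t : R) (A : set V), 0 <= t -> measurable (X t @^-1` A)) /\
  (forall l : seq (R * V), path <=%R 0 (unzip1 l) ->
     Pr [set w | all (fun ty => X ty.1 w == ty.2) l] = (path_prob e 0 x l)%:E).

(* The minus sign is put inside the sum because \esum is meant for families of
   nonnegative terms: P_t(x, z) <= 1 <= m(z), so every term is nonnegative.
   The convention 0 log 0 = 0 holds since ln 0 = 0. *)
Definition heat_entropy (R : realType) (V : choiceType) (e : rel V) (t : R)
    (x : V) : \bar R :=
  \esum_(z in [set: V])
    (- (heat_kernel e t x z * ln (heat_kernel e t x z / (deg e z)%:R)))%:E.

Definition growth_bound (R : realType) (C s : R) : R :=
  expR (C * Num.sqrt (ln s * ln (ln s))).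

(* Main.v *)
Require Import Defs.
From HB Require Import structures.
From mathcomp Require Import all_boot all_order all_algebra finmap.
From mathcomp Require Import all_classical all_reals all_analysis.
From mathcomp Require Import measurable_realfun.
From mathcomp Require Import ring lra zify.

Set Implicit Arguments.
Unset Strict Implicit.
Unset Printing Implicit Defensive.

Import Order.TTheory GRing.Theory Num.Theory.
Import numFieldNormedType.Exports.

Local Open Scope classical_set_scope.
Local Open Scope ring_scope.

(** Write P for the average over neighbours, m for the degree, T_t for the
heat semigroup exp (t (P - 1)), and H_t(x) for the heat entropy.  By weak
duality, non-negative curvature says that the lazy average (1 + P) / 2
does not increase Lipschitz constants; in other words two walkers can be
coupled so that their distance is a supermartingale with bounded increments.

The heart of the proof is a log-Harnack inequality ([log_harnack]): for
bounded phi and r = dist(x, y),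
  T_t phi(x) <= ln (T_t (exp phi)(y)) + a r^2 / t + b ln (1 + 2 t).
To compare the walks from x and from y, give the second one an additional
drift delta = 3 r / (remaining time) towards the first.  Changing the law of
a walk by such a drift costs relative entropy of order delta^2 per unit of
time; the drift makes the distance shrink linearly, which accounts for the
term r^2 / t, and the logarithm pays for the fluctuations of the distance.
That the distance is a supermartingale with constant exactly 1, at every
single step, is what makes this work.  The coupling never appears: the
argument is a backward induction on functions ([log_harnack_discrete]) for
the chains that jump with probability h per step, followed by h -> 0.

Three consequences are combined.
- Entropy step ([entropy_step]).  Compare the law of X_(t+s) with the law of
  X_t by Gibbs' inequality and condition on X_s:
  H_(t+s)(x) <= sup H_t + E_x [a dist(x, X_s)^2 / t + b ln (1 + 2 t)] + 2.
- Displacement ([displacement]).  Lipschitz functions of X_t have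
  sub-Gaussian fluctuations of order sqrt t, so a return from y to x in time
  t has probability at most exp (- u^2 / 8 t) when u = E_y dist(x, X_t) is at
  most 2 t; since the walk is reversible, - ln P_t(x, y) is large too, and
  E_x dist(x, X_2t)^2 <= 8 t H_t(x) + 2 t.
- Volume ([volume_le]).  A set that carries half of the law of X_t and has
  mass exp (4 H_t) is hit from every point of B(x, r) with probability at
  least exp (- 2 (a r^2 / t + b ln (1 + 2 t)) - 2), so by reversibility the
  mass of the ball is at most exp (4 H_t + 2 (a r^2 / t + ...) + 2).

Suppose now that the entropy is at most F up to time s.  By the first two
points, s F is reached in about F steps of length s, the j-th of which adds
O(F / j + ln T) to the entropy as long as all times are at most T.  So
the entropy is at most F L up to time s F, where L = O(ln T)
([entropy_scale]).  After i rounds from time 1 the entropy is at most L^(i+1)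
up to time L^(i (i+1) / 2) ([entropy_iterate]).  Time T is reached for
i of order sqrt (2 ln T / ln L), where the bound L^(i+1) is
exp (O(sqrt (ln T ln (ln T)))).  The bounds on the displacement and, with
t = r^2, on the volume follow. *)

(** * Poisson averages of bounded sequences *)

Section PoissonAverage.
Variable R : realType.
Implicit Types (s t h M : R) (a b : R^nat).

Definition bounded_seq M a := forall k, `|a k| <= M.

Lemma bounded_seqD M N a b : bounded_seq M a -> bounded_seq N b ->
  bounded_seq (M + N) (fun k => a k + b k).
Proof. by move=> aM bN k; rewrite (le_trans (ler_normD _ _))// lerD. Qed.

Definition poisson_avg t a : R :=
  expR (- t) * limn (series (fun k => t ^+ k / k`!%:R * a k)).

Lemma poisson_avg_cvg t M a : bounded_seq M a ->
  cvgn (series (fun k => t ^+ k / k`!%:R * a k)).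
Proof.
move=> aM; have M0 : 0 <= M by apply: le_trans (aM 0%N).
apply: normed_cvg.
apply: (@series_le_cvg _ _ (fun k => M * exp_coeff `|t| k)).
- by move=> n; exact: normr_ge0.
- by move=> n; rewrite mulr_ge0// exp_coeff_ge0.
- move=> n; rewrite /exp_coeff /= !normrM normfV normrX normr_nat mulrC.
  by apply: ler_wpM2r => //; rewrite divr_ge0 ?exprn_ge0.
- exact/is_cvg_seriesZ/is_cvg_series_exp_coeff.
Qed.

Arguments poisson_avg_cvg t {M a}.

Lemma poisson_avg_cst t c : poisson_avg t (fun=> c) = c.
Proof.
rewrite /poisson_avg.
have -> : (fun k => t ^+ k / k`!%:R * c) = c *: exp_coeff t :> (R^nat).
  by apply/funext => k; rewrite /exp_coeff /= mulrC.
rewrite lim_seriesZ; last exact: is_cvg_series_exp_coeff.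
rewrite -/(expR t) /GRing.scale /= mulrCA -expRD addNr expR0 mulr1//.
Qed.

Lemma poisson_avgD t M N a b : bounded_seq M a -> bounded_seq N b ->
  poisson_avg t (fun k => a k + b k) = poisson_avg t a + poisson_avg t b.
Proof.
move=> aM bN; rewrite /poisson_avg -mulrDr; congr (_ * _).
have /= := lim_seriesD (poisson_avg_cvg t aM) (poisson_avg_cvg t bN).
move=> <-; congr (limn (series _)).
by apply/funext => k /=; rewrite mulrDr.
Qed.

Lemma poisson_avgZ t M c a : bounded_seq M a ->
  poisson_avg t (fun k => c * a k) = c * poisson_avg t a.
Proof.
move=> aM; rewrite /poisson_avg mulrCA; congr (_ * _).
set f := (fun k => t ^+ k / k`!%:R * a k).
have <- : limn (series (c *: f)) = c * limn (series f).
  exact: lim_seriesZ (poisson_avg_cvg t aM).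
congr (limn (series _)).
by apply/funext => k /=; rewrite mulrCA.
Qed.

Lemma poisson_avg_ge_term t M a k : 0 <= t -> bounded_seq M a ->
  (forall k, 0 <= a k) ->
  expR (- t) * (t ^+ k / k`!%:R * a k) <= poisson_avg t a.
Proof.
move=> t0 aM a0; rewrite ler_wpM2l ?expR_ge0//.
have p0 i : 0 <= t ^+ i / i`!%:R * a i.
  by rewrite !mulr_ge0 ?exprn_ge0 ?invr_ge0.
apply: (@le_trans _ _ (series (fun k => t ^+ k / k`!%:R * a k) k.+1)).
  by rewrite /series /= big_nat_recr//= lerDr sumr_ge0.
apply: nondecreasing_cvgn_le; last exact: (poisson_avg_cvg t aM).
by apply/nondecreasing_seqP => n; rewrite /series /= big_nat_recr//= lerDl.
Qed.

Lemma poisson_avg_ge0 t M a : 0 <= t -> bounded_seq M a ->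
  (forall k, 0 <= a k) -> 0 <= poisson_avg t a.
Proof.
move=> t0 aM a0; apply: le_trans (poisson_avg_ge_term 0 t0 aM a0).
by rewrite !mulr_ge0 ?expR_ge0.
Qed.

Lemma sum_triangle (F : nat -> nat -> R) (n : nat) :
  \sum_(k < n) \sum_(i < k.+1) F i (k - i)%N =
  \sum_(i < n) \sum_(j < n - i) F i j.
Proof.
elim: n => [|n IH]; first by rewrite !big_ord0.
rewrite big_ord_recr /= IH [RHS]big_ord_recr /= subSn// subnn big_ord1.
rewrite big_ord_recr /= subnn addrA; congr (_ + _).
rewrite -big_split /=; apply: eq_bigr => i _.
by rewrite subSn ?(ltnW (ltn_ord i))// big_ord_recr.
Qed.

Lemma exp_coeff_binomial s t (k : nat) : (s + t) ^+ k / k`!%:R =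
  \sum_(i < k.+1) (s ^+ i / i`!%:R) * (t ^+ (k - i) / (k - i)`!%:R).
Proof.
rewrite addrC exprDn mulr_suml; apply: eq_bigr => i _.
have ik : (i <= k)%N by rewrite -ltnS.
have := bin_fact ik => /(congr1 (fun n => n%:R : R)); rewrite !natrM => bf.
have f0 n : (n`!%:R : R) != 0 by rewrite pnatr_eq0 -lt0n fact_gt0.
rewrite -bf -mulr_natl; field.
by rewrite !f0 pnatr_eq0 -lt0n bin_gt0 ik.
Qed.


(** The Cauchy product.  For non-negative terms the partial sums over squares
are squeezed between partial sums over triangles, which the binomial formula
collapses to the series at time s + t. *)
Lemma poisson_avg_semigroup_ge0 s t M a : 0 <= s -> 0 <= t ->
  bounded_seq M a -> (forall k, 0 <= a k) ->
  poisson_avg s (fun i => poisson_avg t (fun j => a (i + j)%N)) =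
  poisson_avg (s + t) a.
Proof.
move=> s0 t0 aM a0.
pose c (u : R) k : R := u ^+ k / k`!%:R.
have c0 u k : 0 <= u -> 0 <= c u k.
  by move=> u0; rewrite mulr_ge0 ?exprn_ge0 ?invr_ge0.
have aM' i : bounded_seq M (fun j => a (i + j)%N) by move=> j; exact: aM.
pose b i := limn (series (fun j => c t j * a (i + j)%N)).
have b0 i : 0 <= b i.
  have := poisson_avg_ge0 t0 (aM' i) (fun j => a0 _).
  by rewrite /poisson_avg pmulr_rge0 ?expR_gt0.
have cb i : cvgn (series (fun j => c t j * a (i + j)%N)).
  exact: (poisson_avg_cvg t (aM' i)).
have bM : bounded_seq (M * expR t) b.
  move=> i; rewrite ger0_norm //.
  have -> : M * expR t = limn (series (M *: exp_coeff t)).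
    by rewrite lim_seriesZ //; exact: is_cvg_series_exp_coeff.
  apply: lim_series_le => //; first exact/is_cvg_seriesZ/is_cvg_series_exp_coeff.
  move=> n; rewrite /GRing.scale /= mulrC /exp_coeff /=.
  by rewrite ler_wpM2r ?c0 // (le_trans (ler_norm _)).
transitivity (expR (- (s + t)) * limn (series (fun i => c s i * b i))).
  rewrite opprD expRD /poisson_avg -mulrA; congr (_ * _).
  set f := (fun i => c s i * b i).
  have <- : limn (series (expR (- t) *: f)) = expR (- t) * limn (series f).
    by apply: lim_seriesZ; exact: (poisson_avg_cvg s bM).
  congr (limn (series _)); apply/funext => i.
  by rewrite /f /GRing.scale /= mulrCA.
rewrite /poisson_avg; congr (_ * _).
have cL : cvgn (series (fun k => c (s + t) k * a k)).
  exact: (poisson_avg_cvg (s + t) aM).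
have cR : cvgn (series (fun i => c s i * b i)).
  exact: (poisson_avg_cvg s bM).
have sE n : series (fun k => c (s + t) k * a k) n =
    \sum_(i < n) \sum_(j < n - i) c s i * c t j * a (i + j)%N.
  rewrite -(sum_triangle (fun i j => c s i * c t j * a (i + j)%N)).
  rewrite /series /= big_mkord; apply: eq_bigr => k _.
  rewrite /c exp_coeff_binomial mulr_suml; apply: eq_bigr => i _.
  by rewrite subnKC // -ltnS.
have p0 i j : 0 <= c s i * c t j * a (i + j)%N 
  by apply: mulr_ge0 => //; apply: mulr_ge0; exact: c0.
apply/eqP; rewrite eq_le; apply/andP; split.
- apply: limr_le => //; apply: nearW => N.
  have cJ : (fun J => \sum_(i < N) \sum_(j < J) c s i * c t j * a (i + j)%N)
      @ \oo --> series (fun i => c s i * b i) N.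
    rewrite /series /= big_mkord.
    apply: cvg_big => [|i _]; first exact: add_continuous.
    rewrite (_ : (fun _ => _) =
      (fun J => c s i * series (fun j => c t j * a (i + j)%N) J)).
      by apply: cvgMl_tmp; exact: cb.
    apply/funext => J; rewrite /series /= big_mkord mulr_sumr.
    by apply: eq_bigr => j _; rewrite mulrA.
  rewrite -(cvg_lim _ cJ) //; apply: limr_le; first by apply/cvg_ex; eexists; exact: cJ.
  apply: nearW => J.
  apply: (@le_trans _ _ (series (fun k => c (s + t) k * a k) (N + J))); last first.
    apply: nondecreasing_cvgn_le => //.
    apply/nondecreasing_seqP => n; rewrite /series /= big_nat_recr//= lerDl.
    by rewrite mulr_ge0 // c0 // addr_ge0.
  rewrite sE big_split_ord /= -[leLHS]addr0 lerD ?sumr_ge0 //; last first.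
    by move=> i _; apply: sumr_ge0.
  apply: ler_sum => i _.
  have -> : (N + J - i = J + (N - i))%N by rewrite addnC addnBA // ltnW.
  by rewrite big_split_ord /= lerDl sumr_ge0.
- apply: limr_le => //; apply: nearW => N.
  apply: (@le_trans _ _ (series (fun i => c s i * b i) N)); last first.
    apply: nondecreasing_cvgn_le => //.
    by apply/nondecreasing_seqP => n; rewrite /series /= big_nat_recr//= lerDl mulr_ge0 ?c0.
  rewrite sE /series /= big_mkord; apply: ler_sum => i _.
  under eq_bigr do rewrite -mulrA.
  rewrite -mulr_sumr ler_wpM2l ?c0 //.
  have -> : \sum_(j < N - i) c t j * a (i + j)%N =
      series (fun j => c t j * a (i + j)%N) (N - i)%N.
    by rewrite /series /= big_mkord.
  apply: nondecreasing_cvgn_le => //; apply/nondecreasing_seqP => n.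
  by rewrite /series /= big_nat_recr//= lerDl mulr_ge0 ?c0.
Qed.

Lemma poisson_avg_bounded t M a : 0 <= t -> bounded_seq M a ->
  `|poisson_avg t a| <= M.
Proof.
move=> t0 aM.
have cM c : bounded_seq `|c| (fun=> c) by move=> k.
have aMN : bounded_seq M (fun k => -1 * a k).
  by move=> k; rewrite mulN1r normrN; exact: aM.
have B b : bounded_seq M b -> 0 <= poisson_avg t b + M.
  move=> bM; rewrite -[X in _ + X](poisson_avg_cst t) -(poisson_avgD t bM (cM _)).
  apply: (@poisson_avg_ge0 _ (M + `|M|)) => // k.
    by rewrite (le_trans (ler_normD _ _))// lerD2r; exact: bM.
  by rewrite -[X in 0 <= X + _]opprK addrC subr_ge0 (le_trans (ler_norm _))// normrN bM.
rewrite ler_norml; apply/andP; split; first by have := B _ aM; lra.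
by have := B _ aMN; rewrite (poisson_avgZ _ _ aM); lra.
Qed.

Lemma poisson_avg_semigroup s t M a : 0 <= s -> 0 <= t -> bounded_seq M a ->
  poisson_avg s (fun i => poisson_avg t (fun j => a (i + j)%N)) =
  poisson_avg (s + t) a.
Proof.
move=> s0 t0 aM.
have cM c : bounded_seq `|c| (fun=> c) by move=> k.
have aM' i : bounded_seq M (fun j => a (i + j)%N) by move=> j; exact: aM.
have bM : bounded_seq M (fun i => poisson_avg t (fun j => a (i + j)%N)).
  by move=> i; exact: poisson_avg_bounded.
have := @poisson_avg_semigroup_ge0 s t (M + `|M|) (fun k => a k + M) s0 t0.
move=> /(_ _ _)/wrap[].
  by move=> k; rewrite (le_trans (ler_normD _ _))// lerD2r; exact: aM.
  move=> k; have := ler_norm (- a k); rewrite normrN.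
  by move=> /le_trans/(_ (aM k)); lra.
under [X in poisson_avg s X = _ -> _]eq_fun => i.
  rewrite (poisson_avgD t (aM' i) (cM M)) poisson_avg_cst; over.
rewrite (poisson_avgD s bM (cM M)) (poisson_avgD _ aM (cM M)) !poisson_avg_cst.
exact: addIr.
Qed.

Lemma poisson_avg_le t M N a b : 0 <= t -> bounded_seq M a -> bounded_seq N b ->
  (forall k, a k <= b k) -> poisson_avg t a <= poisson_avg t b.
Proof.
move=> t0 aM bN ab; rewrite -subr_ge0.
have aM' : bounded_seq M (fun k => -1 * a k).
  by move=> k; rewrite mulN1r normrN; exact: aM.
have -> : poisson_avg t b - poisson_avg t a =
    poisson_avg t (fun k => b k + -1 * a k).
  by rewrite (poisson_avgD t bN aM') (poisson_avgZ t _ aM) mulN1r.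
apply: (@poisson_avg_ge0 _ (N + M)) => // k.
  by rewrite (le_trans (ler_normD _ _))// lerD ?bN ?aM'.
by rewrite mulN1r subr_ge0.
Qed.

Lemma poisson_avg_delta t i :
  poisson_avg t (fun k => (k == i)%:R) = expR (- t) * (t ^+ i / i`!%:R).
Proof.
congr (_ * _); apply/cvg_lim => //; apply: cvg_near_cst.
exists i.+1 => // n /= iltn; rewrite /series /= big_mkord.
rewrite (bigD1 (Ordinal iltn)) //= eqxx mulr1 big1 ?addr0 // => j.
by rewrite -val_eqE /= => /negbTE ->; rewrite mulr0.
Qed.

(** A Poisson variable of parameter h is 0 or 1 up to an event of probability
O(h^2), and then takes these values with probabilities 1 - h and h up to
O(h^2). *)
Lemma poisson_avg_euler h M a : 0 <= h -> bounded_seq M a ->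
  `|poisson_avg h a - ((1 - h) * a 0%N + h * a 1%N)| <= 3 * h ^+ 2 * M.
Proof.
move=> h0 aM.
have M0 : 0 <= M by apply: le_trans (aM 0%N).
pose e i (k : nat) : R := (k == i)%:R.
have e1 i : bounded_seq 1 (e i).
  by move=> k; rewrite /e; case: eqP; rewrite ?normr1 ?normr0.
pose c i := poisson_avg h (e i).
have c0E : c 0%N = expR (- h).
  by rewrite /c poisson_avg_delta expr0 fact0 divr1 mulr1.
have c1E : c 1%N = expR (- h) * h.
  by rewrite /c poisson_avg_delta expr1 divr1.
(* tl is the indicator of [2, oo), whose Poisson mass is at most h^2. *)
pose tl k : R := (1 + -1 * e 0%N k) + -1 * e 1%N k.
have eM i : bounded_seq 1 (fun k => -1 * e i k).
  by move=> k; rewrite mulN1r normrN; exact: e1.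
have one1 : bounded_seq 1 (fun=> 1 : R) by move=> k; rewrite normr1.
have t1 : bounded_seq 2 (fun k => 1 + -1 * e 0%N k).
  by move=> k; rewrite (le_trans (ler_normD _ _))// -[2]/(1 + 1) lerD ?eM ?one1.
have t2 : bounded_seq 3 tl.
  move=> k; rewrite (le_trans (ler_normD _ _))//.
  by rewrite (_ : 3 = 2 + 1) ?lerD ?eM ?t1 //; lra.
have tlE : poisson_avg h tl = 1 - c 0%N - c 1%N.
  rewrite (poisson_avgD _ t1 (eM _)) (poisson_avgD _ one1 (eM _)).
  by rewrite !(poisson_avgZ _ _ (e1 _)) poisson_avg_cst !mulN1r.
have bZ i : bounded_seq `|a i| (fun k => a i * e i k).
  by move=> k; rewrite normrM ler_piMr // e1.
have b01 : bounded_seq (`|a 0%N| + `|a 1%N|)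
    (fun k => a 0%N * e 0%N k + a 1%N * e 1%N k).
  by move=> k; rewrite (le_trans (ler_normD _ _))// lerD ?bZ.
have b01E : poisson_avg h (fun k => a 0%N * e 0%N k + a 1%N * e 1%N k) =
    a 0%N * c 0%N + a 1%N * c 1%N.
  by rewrite (poisson_avgD _ (bZ _) (bZ _)) !(poisson_avgZ _ _ (e1 _)).
have MtB : bounded_seq (M * 3) (fun k => M * tl k).
  by move=> k; rewrite normrM (ger0_norm M0) ler_wpM2l.
have NMtB : bounded_seq (M * 3) (fun k => - M * tl k).
  by move=> k; rewrite normrM normrN (ger0_norm M0) ler_wpM2l.
have tlk k : `|a k - (a 0%N * e 0%N k + a 1%N * e 1%N k)| <= M * tl k.
  rewrite /tl /e; case: k => [|[|k]] /=.
  - by rewrite ?mulr1 ?mulr0 ?addr0 subrr normr0; lra.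
  - by rewrite ?mulr1 ?mulr0 ?addr0 ?add0r subrr normr0; lra.
  - by rewrite !mulr0 !addr0 subr0 mulr1; exact: aM.
have ub : poisson_avg h a <= a 0%N * c 0%N + a 1%N * c 1%N + M * (1 - c 0%N - c 1%N).
  rewrite -b01E -tlE -(poisson_avgZ _ _ t2) -(poisson_avgD _ b01 MtB).
  apply: (poisson_avg_le h0 aM (bounded_seqD b01 MtB)) => k.
  by have := tlk k; rewrite ler_norml => /andP[_]; lra.
have lb : a 0%N * c 0%N + a 1%N * c 1%N - M * (1 - c 0%N - c 1%N) <= poisson_avg h a.
  rewrite -b01E -tlE -mulNr -(poisson_avgZ _ _ t2) -(poisson_avgD _ b01 NMtB).
  apply: (poisson_avg_le h0 (bounded_seqD b01 NMtB) aM) => k.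
  by have := tlk k; rewrite ler_norml => /andP[]; lra.
have E1 : 1 - h <= expR (- h) by have := expR_ge1Dx (- h).
have E2 : expR (- h) <= 1 - h + h ^+ 2.
  rewrite expRN -[leLHS]mul1r ler_pdivrMr ?expR_gt0 //.
  apply: (@le_trans _ _ ((1 - h + h ^+ 2) * (1 + h))).
    rewrite (_ : _ * _ = 1 + h ^+ 3); last by ring.
    by rewrite lerDl exprn_ge0.
  by rewrite ler_wpM2l ?expR_ge1Dx //; nra.
have := aM 0%N; have := aM 1%N; rewrite !ler_norml => /andP[a1 a1'] /andP[a0 a0'].
rewrite c0E c1E in ub lb.
have q : 1 - expR (- h) - expR (- h) * h <= h ^+ 2 by nra.
have q0 : `|a 0%N * (expR (- h) - (1 - h))| <= M * h ^+ 2.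
  rewrite normrM ler_pM // ger0_norm; lra.
have q1 : `|a 1%N * (expR (- h) * h - h)| <= M * h ^+ 2.
  have E3 : expR (- h) <= 1 by rewrite expR_le1 oppr_le0.
  rewrite (_ : _ * h - h = - (h * (1 - expR (- h)))); last by ring.
  rewrite normrM normrN ler_pM // ger0_norm ?mulr_ge0 ?subr_ge0 //.
  by rewrite expr2 ler_wpM2l //; lra.
have q2 : M * (1 - expR (- h) - expR (- h) * h) <= M * h ^+ 2 by rewrite ler_wpM2l.
move: q0 q1; rewrite !ler_norml => /andP[q0 q0'] /andP[q1 q1'].
by apply/andP; split; lra.
Qed.

End PoissonAverage.

(** * Markov operators acting on functions *)

Section MarkovOperators.
Variables (R : realType) (V : choiceType).
Implicit Types (A : (V -> R) -> V -> R) (f g : V -> R) (x y z : V).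

(** Averaging operators on all functions, bounded or not.  They include the
finite-range operators and their iterates, but not the heat semigroup, which
only makes sense on bounded functions. *)
Record markov_op A : Prop := Markov {
  markovD : forall f g x, A (fun z => f z + g z) x = A f x + A g x;
  markovZ : forall c f x, A (fun z => c * f z) x = c * A f x;
  markov_cst : forall c x, A (fun=> c) x = c;
  markov_le : forall f g, (forall z, f z <= g z) -> forall x, A f x <= A g x }.

Definition bounded_by M f := forall x, `|f x| <= M.

Lemma bounded_byD M N f g : bounded_by M f -> bounded_by N g ->
  bounded_by (M + N) (fun x => f x + g x).
Proof. by move=> fM gN x; rewrite (le_trans (ler_normD _ _)) // lerD. Qed.

Lemma markov_bounded A M f : markov_op A -> bounded_by M f -> bounded_by M (A f).
Proof.
move=> mA fM x; have lb : A (fun=> - M) x <= A f x.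
  by apply: (markov_le mA) => z; have := fM z; rewrite ler_norml => /andP[].
have ub : A f x <= A (fun=> M) x.
  by apply: (markov_le mA) => z; have := fM z; rewrite ler_norml => /andP[].
by rewrite ler_norml -{1}(markov_cst mA (- M) x) lb -(markov_cst mA M x).
Qed.

Lemma markovN A f x : markov_op A -> A (fun z => - f z) x = - A f x.
Proof.
move=> mA; rewrite -mulN1r -(markovZ mA); congr (A _ x).
by apply/funext => z; rewrite mulN1r.
Qed.

Lemma markovB A f g x : markov_op A -> A (fun z => f z - g z) x = A f x - A g x.
Proof. by move=> mA; rewrite (markovD mA) markovN. Qed.

(** Jensen's inequality, from the tangent to expR at A f x. *)
Lemma markov_jensen_expR A f x : markov_op A ->
  expR (A f x) <= A (fun z => expR (f z)) x.
Proof.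
move=> mA; set c := A f x.
have : A (fun z => expR c * (1 - c + f z)) x <= A (fun z => expR (f z)) x.
  apply: (markov_le mA) => z.
  rewrite -[in leRHS](subrKC c (f z)) expRD ler_wpM2l ?expR_ge0 //.
  by rewrite (le_trans _ (expR_ge1Dx _)) //; lra.
by rewrite (markovZ mA) (markovD mA) (markov_cst mA) -/c subrK mulr1.
Qed.

Lemma markov_iter A n : markov_op A -> markov_op (iter n A).
Proof.
move=> mA; elim: n => [|n IH]; first by split.
split=> /= [f g x|c f x|c x|f g fg x].
- rewrite -(markovD mA); congr (A _ x); apply/funext => z.
  by rewrite (markovD IH).
- rewrite -(markovZ mA); congr (A _ x); apply/funext => z.
  by rewrite (markovZ IH).
- rewrite (_ : iter n A (fun=> c) = fun=> c) ?(markov_cst mA) //.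
  by apply/funext => z; rewrite (markov_cst IH).
- by apply: (markov_le mA) => z; apply: (markov_le IH).
Qed.

Lemma markov_id : markov_op id.
Proof. by split. Qed.

Lemma markov_mix A B (h : R) : markov_op A -> markov_op B -> 0 <= h <= 1 ->
  markov_op (fun f x => (1 - h) * A f x + h * B f x).
Proof.
move=> mA mB /andP[h0 h1]; split=> [f g x|c f x|c x|f g fg x].
- by rewrite (markovD mA) (markovD mB); ring.
- by rewrite (markovZ mA) (markovZ mB); ring.
- by rewrite (markov_cst mA) (markov_cst mB); ring.
- by rewrite lerD // ler_wpM2l ?subr_ge0 ?(markov_le mA) ?(markov_le mB).
Qed.

(** The Euler step of size h of the semigroup generated by A - 1. *)
Definition lazy A h f x := (1 - h) * f x + h * A f x.

Lemma markov_lazy A h : markov_op A -> 0 <= h <= 1 -> markov_op (lazy A h).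
Proof. by move=> mA; apply: (markov_mix markov_id mA). Qed.

End MarkovOperators.

(** * Unordered sums and duplicate-free sequences *)

Section EsumSeq.
Variables (R : realType) (T : choiceType).
Implicit Types (a : T -> R) (s : seq T).

Lemma sum_le_esum (S : set T) a s : uniq s -> {in s, forall i, S i} ->
  ((\sum_(i <- s) a i)%:E <= \esum_(i in S) (a i)%:E)%E.
Proof.
move=> us sS; apply: esum_ge; exists [set` s].
  by split => // i /= /sS.
by rewrite -fsbig_seq // sumEFin.
Qed.

Lemma esum_le_seq (S : set T) a (B : \bar R) :
  (forall s, uniq s -> {in s, forall i, S i} -> ((\sum_(i <- s) a i)%:E <= B)%E) ->
  (\esum_(i in S) (a i)%:E <= B)%E.
Proof.
move=> H; apply: ge_ereal_sup => _ [X [finX XS] <-].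
rewrite fsbig_finite // sumEFin; apply: H; first exact: fset_uniq.
by move=> i; rewrite in_fset_set // inE => /XS.
Qed.

Lemma esum_supp a s : uniq s -> (forall i, 0 <= a i) ->
  (forall i, i \notin s -> a i = 0) ->
  (\esum_(i in [set: T]) (a i)%:E = (\sum_(i <- s) a i)%:E)%E.
Proof.
move=> us a0 as0.
transitivity (\esum_(i in [set` s]) (a i)%:E)%E.
  rewrite [RHS]esum_mkcond; apply: eq_esum => i _.
  by rewrite mem_setE; case: ifPn => // /as0 ->.
rewrite esum_fset //; first by rewrite -fsbig_seq // sumEFin.
by move=> i _; rewrite lee_fin.
Qed.

End EsumSeq.

(** * The graph distance *)

Section GraphDistance.
Variables (V : choiceType) (e : rel V).
Hypotheses (esym : symmetric e) (econ : connected_graph e).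
Implicit Types x y z : V.

Lemma dist_walk x y : has_walk e x y (dist e x y).
Proof.
rewrite /dist; case: pselect => [h|[]]; first by case: ex_minnP => n /asboolP.
by have [n w] := econ x y; exists n; apply/asboolP.
Qed.

Lemma dist_le x y n : has_walk e x y n -> (dist e x y <= n)%N.
Proof.
move=> w; rewrite /dist; case: pselect => [h|[]]; last by exists n; apply/asboolP.
by case: ex_minnP => m _; apply; apply/asboolP.
Qed.

Lemma has_walk_rev x y n : has_walk e x y n -> has_walk e y x n.
Proof.
move=> [p [xp <- <-]]; exists (rev (belast x p)); split.
- by rewrite (eq_path (e' := fun u v => e v u)) ?rev_path // => u v; rewrite esym.
- by case: p {xp} => //= a p; rewrite rev_cons last_rcons.
- by rewrite size_rev size_belast.
Qed.

Lemma has_walk_cat x y z m n :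
  has_walk e x y m -> has_walk e y z n -> has_walk e x z (m + n).
Proof.
move=> [p [xp py <-]] [q [yq qz <-]]; exists (p ++ q); split.
- by rewrite cat_path xp py.
- by rewrite last_cat py.
- by rewrite size_cat.
Qed.

Lemma distC x y : dist e x y = dist e y x.
Proof.
by apply/eqP; rewrite eqn_leq !dist_le //; apply: has_walk_rev; exact: dist_walk.
Qed.

Lemma dist_triangle x y z : (dist e x z <= dist e x y + dist e y z)%N.
Proof. by apply: dist_le; apply: has_walk_cat; exact: dist_walk. Qed.

Lemma dist_adj x y : e x y -> (dist e x y <= 1)%N.
Proof. by move=> xy; apply: dist_le; exists [:: y]; rewrite /= xy. Qed.

Lemma distxx x : dist e x x = 0%N.
Proof. by apply/eqP; rewrite -leqn0 dist_le //; exists [::]. Qed.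

Lemma dist_eq0 x y : dist e x y = 0%N -> x = y.
Proof.
have [p [_ <-]] := dist_walk x y; move=> sp /[dup] h.
by move: sp; rewrite h => /size0nil ->.
Qed.

Lemma dist_pred x y r : dist e x y = r.+1 -> exists2 y', e y y' & dist e x y' = r.
Proof.
rewrite distC => h; have [p [yp px sp]] := dist_walk y x.
case: p => [|y' p] in yp px sp; first by rewrite h in sp.
move: yp => /= /andP[yy' y'p]; exists y' => //; apply/eqP; rewrite eqn_leq.
have sp' : size p = r by apply/eqP; rewrite -eqSS -h -sp.
apply/andP; split; first by rewrite distC -sp'; apply: dist_le; exists p.
have := dist_triangle y y' x; rewrite h (distC x y') -(leq_add2l 1%N r) add1n.
by move=> /leq_trans; apply; rewrite leq_add2r; exact: dist_adj.
Qed.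

End GraphDistance.

(** * Lipschitz contraction and the discrete log-Harnack inequality *)

Record curved_graph (R : realType) (V : choiceType) (e : rel V) (d : nat)
    : Prop := CurvedGraph {
  graph_sym : symmetric e;
  graph_irr : irreflexive e;
  graph_lf : locally_finite_graph e;
  graph_con : connected_graph e;
  graph_edge : exists x y, e x y;
  graph_deg : forall x, (deg e x <= d)%N;
  graph_curv : nonneg_ollivier_ricci R e }.

Section RandomWalk.
Variables (R : realType) (V : choiceType) (e : rel V) (d : nat).
Hypothesis G : curved_graph R e d.
Let esym := graph_sym G.
Let eirr := graph_irr G.
Let elf := graph_lf G.
Let econ := graph_con G.
Let eedge := graph_edge G.
Let edeg := graph_deg G.
Let curv := graph_curv G.
Implicit Types (f g : V -> R) (x y z : V).

Definition nbrs x : {fset V} := fset_set (neighbors e x).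

Lemma in_nbrs x y : (y \in nbrs x) = e x y.
Proof. by rewrite in_fset_set ?mem_setE. Qed.

Lemma deg_gt0 x : (0 < deg e x)%N.
Proof.
have [a [b ab]] := eedge.
suff [y xy] : exists y, e x y.
  by rewrite cardfs_gt0; apply/fset0Pn; exists y; rewrite in_nbrs.
have [<-|xa] := eqVneq a x; first by exists b.
have [n [[|y p] [/= xp la _]]] := econ x a; first by rewrite la eqxx in xa.
by exists y; case/andP: xp.
Qed.

Definition nbr_avg f x : R := (deg e x)%:R^-1 * \sum_(z <- nbrs x) f z.

Lemma nbr_avg_finite x : exists (s : seq V) (w : V -> R),
  forall f, nbr_avg f x = \sum_(z <- s) w z * f z.
Proof.
by exists (nbrs x), (fun=> (deg e x)%:R^-1) => f; rewrite /nbr_avg mulr_sumr.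
Qed.

Lemma degR_gt0 x : 0 < (deg e x)%:R :> R.
Proof. by rewrite ltr0n deg_gt0. Qed.

Lemma degR_neq0 x : (deg e x)%:R != 0 :> R.
Proof. by rewrite gt_eqF // degR_gt0. Qed.

Lemma d_ge1 : 1 <= d%:R :> R.
Proof.
have [x _] := eedge; rewrite ler1n; exact: leq_trans (deg_gt0 x) (edeg x).
Qed.

Lemma markov_nbr_avg : markov_op nbr_avg.
Proof.
split=> [f g x|c f x|c x|f g fg x]; rewrite /nbr_avg.
- by rewrite big_split mulrDr.
- by rewrite -mulr_sumr mulrCA.
- rewrite big_const_seq count_predT iter_addr_0 -[size _]/(deg e x).
  by rewrite -(mulr_natl c) mulrA mulVf ?mul1r // degR_neq0.
- by rewrite ler_wpM2l ?invr_ge0 // ler_sum.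
Qed.

Lemma sum_rw_kernel f x : \sum_(z \in [set: V]) rw_kernel R e x z * f z = nbr_avg f x.
Proof.
rewrite (@fsbigTE _ _ _ _ (nbrs x)) => [|z]; last first.
  by rewrite in_nbrs /rw_kernel => /negbTE ->; rewrite !mul0r.
rewrite /nbr_avg mulr_sumr !big_seq; apply: eq_bigr => z.
by rewrite in_nbrs /rw_kernel => ->; rewrite mul1r.
Qed.

Definition ind y z : R := (z == y)%:R.

Lemma rw_kernel_powE k x y : rw_kernel_pow R e k x y = iter k nbr_avg (ind y) x.
Proof.
elim: k x => [//|k IH] x /=.
rewrite -sum_rw_kernel; apply: eq_fsbigr => z _.
by rewrite IH.
Qed.

Definition lip c f := forall x y, f x - f y <= c * (dist e x y)%:R.

Lemma lip_adj c f : 0 <= c -> (forall x y, e x y -> f x - f y <= c) -> lip c f.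
Proof.
move=> c0 fc x y; have [p [xp <- <-]] := dist_walk econ x y.
elim: p x xp => [|z p IH] x /=; first by rewrite subrr mulr0.
case/andP=> xz zp; rewrite -(subrKA (f z)) mulrS mulrDr mulr1 lerD ?fc //.
exact: IH.
Qed.

(** The easy half of Kantorovich duality.  A coupling of two finitely supported
laws is itself finitely supported, so all sums are finite. *)
Lemma coupling_lip (mu nu : V -> R) pi (s s' : seq V) f :
  coupling mu nu pi -> uniq s -> uniq s' ->
  (forall u, u \notin s -> mu u = 0) -> (forall v, v \notin s' -> nu v = 0) ->
  lip 1 f ->
  ((\sum_(u <- s) mu u * f u - \sum_(v <- s') nu v * f v)%:E <=
   \esum_(uv in [set: V * V]) ((dist e uv.1 uv.2)%:R * pi uv)%:E)%E.
Proof.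
move=> [pi0 pi1 pi2] us us' mus nus' fL.
have z1 u v : u \notin s -> pi (u, v) = 0.
  move=> /mus mu0; apply/eqP; rewrite eq_le pi0 andbT -lee_fin -mu0 -pi1.
  have := @sum_le_esum _ _ [set: V] (fun v => pi (u, v)) [:: v].
  by rewrite big_seq1; apply.
have z2 u v : v \notin s' -> pi (u, v) = 0.
  move=> /nus' nu0; apply/eqP; rewrite eq_le pi0 andbT -lee_fin -nu0 -pi2.
  have := @sum_le_esum _ _ [set: V] (fun u => pi (u, v)) [:: u].
  by rewrite big_seq1; apply.
have m1 u : mu u = \sum_(v <- s') pi (u, v).
  by apply: EFin_inj; rewrite -pi1 (esum_supp us') // => v /z2.
have m2 v : nu v = \sum_(u <- s) pi (u, v).
  by apply: EFin_inj; rewrite -pi2 (esum_supp us) // => u /z1.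
apply: le_trans (_ : ((\sum_(uv <- [seq (u, v) | u <- s, v <- s'])
   (dist e uv.1 uv.2)%:R * pi uv)%:E <= _)%E); last first.
  apply: (@sum_le_esum _ _ [set: V * V] (fun uv => (dist e uv.1 uv.2)%:R * pi uv)) => //.
  by apply: allpairs_uniq => // -[? ?] [? ?].
rewrite lee_fin big_allpairs.
under [X in X - _]eq_bigr do rewrite m1 mulr_suml.
under [X in _ - X]eq_bigr do rewrite m2 mulr_suml.
rewrite [X in _ - X]exchange_big /= -sumrB ler_sum // => u _.
rewrite -sumrB ler_sum // => v _.
by rewrite -mulrBr mulrC ler_wpM2r // (le_trans (fL u v)) ?mul1r.
Qed.

Definition one_half : R := 2^-1.

Lemma lazy_kernel_sum f x :
  \sum_(u <- x :: nbrs x) lazy_kernel R e x u * f u = lazy nbr_avg one_half f x.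
Proof.
rewrite big_cons /lazy_kernel /rw_kernel /idk eqxx eirr mul0r addr0 mulr1.
rewrite /lazy /one_half; congr (_ + _); first by congr (_ * _); lra.
rewrite /nbr_avg !mulr_sumr !big_seq; apply: eq_bigr => z; rewrite in_nbrs => xz.
rewrite xz (_ : x == z = false); first by rewrite add0r mul1r mulrA.
by apply/negP => /eqP xz'; rewrite xz' eirr in xz.
Qed.

Lemma lazy_half_adj f x y : e x y -> lip 1 f ->
  lazy nbr_avg one_half f x - lazy nbr_avg one_half f y <= 1.
Proof.
move=> xy fL; rewrite -lee_fin; apply: le_trans (curv xy).
apply: le_ereal_inf_tmp => _ [pi cpi <-].
have supp z u : u \notin z :: nbrs z -> lazy_kernel R e z u = 0.
  rewrite inE in_nbrs negb_or /lazy_kernel /idk /rw_kernel eq_sym.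
  by move=> /andP[/negbTE -> /negbTE ->]; rewrite mul0r addr0 mulr0.
have us z : uniq (z :: nbrs z) by rewrite /= in_nbrs eirr fset_uniq.
rewrite -!lazy_kernel_sum.
exact: (coupling_lip cpi (us x) (us y) (supp x) (supp y) fL).
Qed.

Lemma half01 : 0 <= one_half <= 1.
Proof. by rewrite /one_half; apply/andP; split; lra. Qed.

(** The only consequence of the curvature hypothesis that is used.  The
hypothesis concerns adjacent points; chaining along a geodesic extends the
contraction to all pairs. *)
Lemma lazy_half_lip c f : 0 <= c -> lip c f -> lip c (lazy nbr_avg one_half f).
Proof.
rewrite le_eqVlt => /predU1P[<-|c0] fL; last first.
  apply: lip_adj => [|x y xy]; first exact: ltW.
  have fL' : lip 1 (fun z => c^-1 * f z).
    move=> u v; rewrite -mulrBr ler_pdivrMl // mul1r; exact: fL.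
  have := lazy_half_adj xy fL'.
  rewrite !(markovZ (markov_lazy markov_nbr_avg half01)) -mulrBr.
  by rewrite ler_pdivrMl // mulr1.
have fE x y : f x = f y.
  apply/eqP; rewrite eq_le -subr_le0 -[X in _ && X]subr_le0.
  by have := fL x y; have := fL y x; rewrite !mul0r => -> ->.
move=> x y; rewrite mul0r.
have -> : f = fun=> f x by apply/funext => z; exact: fE.
by rewrite !(markov_cst (markov_lazy markov_nbr_avg half01)) subrr.
Qed.

(** Laziness 1/2 is what the curvature hypothesis controls; every lazier walk
is a mixture of it with the identity, and inherits the contraction. *)
Lemma lazy_split h f x :
  lazy nbr_avg h f x = (1 - 2 * h) * f x + 2 * h * lazy nbr_avg one_half f x.
Proof. by rewrite /lazy /one_half; field. Qed.

Lemma lazy_lip h c f : 0 <= h <= one_half -> 0 <= c -> lip c f -> lip c (lazy nbr_avg h f).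
Proof.
move=> /andP[h0 h1] c0 fL x y; rewrite (lazy_split h f x) (lazy_split h f y).
have h2 : 0 <= 1 - 2 * h by move: h1; rewrite /one_half; lra.
have h3 : 0 <= 2 * h by rewrite mulr_ge0.
have A := ler_wpM2l h2 (fL x y).
have B := ler_wpM2l h3 (lazy_half_lip c0 fL x y).
move: A B; move: (lazy _ _ _ x) (lazy _ _ _ y) (f x) (f y) (c * _).
by move=> u v p q r; lra.
Qed.

Lemma nbr_avg_le_local f g x : (forall z, e x z -> f z <= g z) -> nbr_avg f x <= nbr_avg g x.
Proof.
move=> fg; rewrite /nbr_avg ler_wpM2l ?invr_ge0 // !big_seq ler_sum // => z.
by rewrite in_nbrs; exact: fg.
Qed.

Lemma lazy_le_local h f g x : 0 <= h <= 1 -> f x <= g x ->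
  (forall z, e x z -> f z <= g z) -> lazy nbr_avg h f x <= lazy nbr_avg h g x.
Proof.
move=> /andP[h0 h1] fgx fg; rewrite /lazy lerD // ler_wpM2l ?subr_ge0 //.
exact: nbr_avg_le_local.
Qed.

(** Comparing g and W up to a quadratic function of the distance survives one
half-lazy step, at the price 4 A.  In terms of a coupling: the distance moves
by at most 2 and does not grow on average.  In terms of functions: the square
is linearised at the current distance, g is replaced by the smallest
Lipschitz function H above it near x, and H contracts. *)
Lemma half_step_quadratic (A B : R) g W x y : 0 <= A ->
  (forall x' y', g x' - W y' <= A * (dist e x' y')%:R ^+ 2 + B) ->
  lazy nbr_avg one_half g x - lazy nbr_avg one_half W y <=
    A * (dist e x y)%:R ^+ 2 + B + 4 * A.
Proof.
move=> A0 gW; set r : R := (dist e x y)%:R.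
have r0 : 0 <= r by rewrite ler0n.
pose c := 2 * A * r; have c0 : 0 <= c by rewrite !mulr_ge0.
(* c is the slope of A r^2; H is the largest of the cones of slope c below g. *)
pose T z x' := g x' - c * (dist e x' z)%:R.
pose H z := \big[Order.max/T z x]_(x' <- nbrs x) T z x'.
have HL : lip c H.
  move=> u v; rewrite lerBlDr.
  have Tuv x' : T u x' <= c * (dist e u v)%:R + T v x'.
    have : c * (dist e x' v)%:R <= c * ((dist e u v)%:R + (dist e x' u)%:R).
      by rewrite ler_wpM2l // -natrD ler_nat addnC; exact: dist_triangle.
    by rewrite mulrDr /T; lra.
  have Hx' x' : x' \in x :: nbrs x -> T v x' <= H v.
    rewrite inE => /predU1P[->|x'x]; first exact: bigmax_ge_id.
    exact: le_bigmax_seq.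
  rewrite /H big_seq; apply: bigmax_le => [|x' x'x].
    by apply: le_trans (Tuv x) _; rewrite lerD2l Hx' // mem_head.
  by apply: le_trans (Tuv x') _; rewrite lerD2l Hx' // inE x'x orbT.
have gH z : z \in x :: nbrs x -> g z <= H z.
  have -> : g z = T z z by rewrite /T distxx mulr0 subr0.
  rewrite inE => /predU1P[->|zx]; first exact: bigmax_ge_id.
  exact: le_bigmax_seq.
have TW z x' : x' \in x :: nbrs x -> z \in y :: nbrs y ->
    T z x' <= W z + (A * r ^+ 2 + B + 4 * A - c * r).
  move=> xx' yz; set D : R := (dist e x' z)%:R.
  have d1 u v : v \in u :: nbrs u -> (dist e u v <= 1)%N.
    rewrite inE => /predU1P[->|]; first by rewrite distxx.
    by rewrite in_nbrs; exact: dist_adj.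
  have D1 : D <= r + 2.
    rewrite /D /r -natrD ler_nat (leq_trans (dist_triangle econ x' x z)) //.
    rewrite addn2 -add1n leq_add ?(distC esym econ x') ?d1 // -addn1.
    by rewrite (leq_trans (dist_triangle econ x y z)) // leq_add2l d1.
  have D2 : r <= D + 2.
    rewrite /D /r -natrD ler_nat (leq_trans (dist_triangle econ x x' y)) //.
    rewrite addn2 -add1n leq_add ?d1 // -addn1.
    rewrite (leq_trans (dist_triangle econ x' z y)) // leq_add2l.
    by rewrite (distC esym econ) d1.
  have := gW x' z; rewrite -/D /T -/D /c => gWz.
  have : A * ((D - r) ^+ 2) <= A * 4 by rewrite ler_wpM2l //; nra.
  by lra.
have HW z : z \in y :: nbrs y -> H z <= W z + (A * r ^+ 2 + B + 4 * A - c * r).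
  move=> zy; rewrite /H big_seq; apply: bigmax_le => [|x' x'x].
    by apply: TW => //; exact: mem_head.
  by apply: TW => //; rewrite inE x'x orbT.
have s1 : lazy nbr_avg one_half g x <= lazy nbr_avg one_half H x.
  apply: lazy_le_local => [||z xz]; first exact: half01.
    by apply: gH; exact: mem_head.
  by apply: gH; rewrite inE in_nbrs xz orbT.
have s2 := lazy_half_lip c0 HL x y.
have s3 : lazy nbr_avg one_half H y <=
    lazy nbr_avg one_half (fun z => W z + (A * r ^+ 2 + B + 4 * A - c * r)) y.
  apply: lazy_le_local => [||z yz]; first exact: half01.
    by apply: HW; exact: mem_head.
  by apply: HW; rewrite inE in_nbrs yz orbT.
have mP := markov_lazy markov_nbr_avg half01.
by move: s3; rewrite (markovD mP) (markov_cst mP); move: s2; rewrite -/r; lra.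
Qed.

(** Bounds the relative entropy, per unit of time and in units of delta^2, of
adding a drift of rate delta. *)
Definition tilt_cst : R := d%:R + 1.
Local Notation D := tilt_cst.

(** The Gibbs variational principle ln K(exp W) >= Q W - KL(Q | K) at y, where K
is the lazy step and Q is obtained from K by moving mass h delta from y
itself to its neighbour y'.  Here rho is the density of Q with respect to K,
and KL(Q | K) is bounded by the chi-square divergence. *)
Lemma tilted_jensen h delta W y y' : 0 <= h <= 4^-1 -> 0 <= delta ->
  h * delta <= 2^-1 -> e y y' ->
  expR (lazy nbr_avg h W y + h * delta * (W y' - W y) - h * delta ^+ 2 * D) <=
  lazy nbr_avg h (fun z => expR (W z)) y.
Proof.
move=> /andP[h0 h4] de0 hde yy'; set c := _ - h * _ * D.
have h1 : 1 - h > 0 by lra.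
have mK : markov_op (lazy nbr_avg h) by apply: markov_lazy markov_nbr_avg _; lra.
have y'y : (y == y') = false by apply/negP => /eqP E; rewrite E eirr in yy'.
pose alpha := delta * (deg e y)%:R; pose beta := h * delta / (1 - h).
have al0 : 0 <= alpha by rewrite mulr_ge0.
have beE : beta * (1 - h) = h * delta by rewrite /beta divfK // gt_eqF.
have be0 : 0 <= beta by rewrite divr_ge0 ?mulr_ge0 // ltW.
have be1 : beta < 1 by rewrite ltr_pdivrMr //; lra.
(* rho is the density of Q with respect to K. *)
pose rho z := 1 + alpha * ind y' z - beta * ind y z.
have rho0 z : 0 < rho z.
  rewrite /rho /ind; case: eqP => [->|_]; first by rewrite (eq_sym y') y'y mulr1 mulr0; lra.
  by case: eqP => _; rewrite ?mulr1 !mulr0; lra.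
(* exp u >= rho (1 + u - ln rho) and ln rho <= rho - 1. *)
have ptw z : rho z * (2 + (W z - c) - rho z) <= expR (W z - c).
  have lnr : ln (rho z) <= rho z - 1.
    rewrite -[X in ln X](subrKC 1); apply: le_ln1Dx.
    by have := rho0 z; lra.
  rewrite -[in leRHS](subrK (ln (rho z)) (W z - c)) expRD lnK ?posrE //.
  rewrite mulrC ler_wpM2r ?(ltW (rho0 z)) //.
  by apply: le_trans (expR_ge1Dx _); lra.
have Kind g : lazy nbr_avg h (fun z => rho z * g z) y =
    lazy nbr_avg h g y + h * delta * (g y' - g y).
  have -> : (fun z => rho z * g z) =
      (fun z => (g z + alpha * (ind y' z * g z)) + - beta * (ind y z * g z)).
    by apply/funext => z; rewrite /rho; ring.
  rewrite !(markovD mK) !(markovZ mK).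
  have -> : lazy nbr_avg h (fun z => ind y z * g z) y = (1 - h) * g y.
    rewrite /lazy /ind eqxx mul1r /nbr_avg big_seq big1 ?mulr0 ?addr0 // => z.
    rewrite in_nbrs => yz; case: eqP yz => [->|]; first by rewrite eirr.
    by rewrite mul0r.
  have -> : lazy nbr_avg h (fun z => ind y' z * g z) y = h * ((deg e y)%:R^-1 * g y').
    rewrite /lazy /ind y'y mul0r mulr0 add0r /nbr_avg (big_fsetD1 y') ?in_nbrs //=.
    rewrite eqxx mul1r big_seq big1 ?addr0 // => z.
    by rewrite in_fsetD1 => /andP[/negbTE -> _]; rewrite mul0r.
  have -> : alpha * (h * ((deg e y)%:R^-1 * g y')) = h * delta * g y'.
    by rewrite /alpha; field; exact: degR_neq0.
  by rewrite mulrA mulNr beE; ring.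
have ge1 : 1 <= lazy nbr_avg h (fun z => expR (W z - c)) y.
  apply: le_trans (markov_le mK ptw y); rewrite Kind.
  have -> : lazy nbr_avg h (fun z => 2 + (W z - c) - rho z) y =
      2 + (lazy nbr_avg h W y - c) - lazy nbr_avg h rho y.
    by rewrite (markovB _ _ _ mK) (markovD mK) (markovB _ _ _ mK) !(markov_cst mK).
  have -> : lazy nbr_avg h rho y = 1.
    have := Kind (fun=> 1); rewrite (markov_cst mK) subrr mulr0 addr0.
    by under [X in lazy nbr_avg h X]eq_fun do rewrite mulr1.
  have -> : rho y' = 1 + alpha.
    by rewrite /rho /ind eqxx (eq_sym y') y'y mulr1 mulr0 subr0.
  have -> : rho y = 1 - beta by rewrite /rho /ind eqxx y'y mulr1 mulr0 addr0.
  have hd0 : 0 <= h * delta by rewrite mulr_ge0.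
  have ab : h * delta * (alpha + beta) <= h * delta ^+ 2 * D.
    rewrite expr2 mulrA -(mulrA (h * delta)) ler_wpM2l //.
    rewrite /D mulrDr lerD ?ler_wpM2l ?ler_nat // mulr1.
    by rewrite ler_pdivrMr //; nra.
  rewrite /c; move: ab; set Z := h * delta ^+ 2 * D; lra.
have : lazy nbr_avg h (fun z => expR c * expR (W z - c)) y =
    lazy nbr_avg h (fun z => expR (W z)) y.
  by congr (lazy nbr_avg h _ y); apply/funext => z; rewrite -expRD subrKC.
by rewrite (markovZ mK) => <-; rewrite ler_peMr // expR_ge0.
Qed.

(** The constants a and b are dictated by [harnack_cost_recursion]. *)
Definition quad_cst : R := 9 * D.
Definition log_cst : R := 144 * quad_cst.
Local Notation a := quad_cst.
Local Notation b := log_cst.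

Lemma tilt_cst_ge2 : 2 <= D. Proof. by rewrite /D; have := d_ge1; lra. Qed.

Lemma quad_cst_ge18 : 18 <= a. Proof. by rewrite /a; have := tilt_cst_ge2; lra. Qed.

Lemma log_cst_ge0 : 0 <= b. Proof. by rewrite /b; have := quad_cst_ge18; lra. Qed.

#[local] Hint Resolve log_cst_ge0 : core.

(** The cost of merging two walkers at distance r within time t. *)
Definition harnack_cost t r : R := a * r ^+ 2 / t + b * ln (1 + t).

Lemma harnack_cost_ge0 t r : 0 <= t -> 0 <= harnack_cost t r.
Proof.
move=> t0; rewrite /harnack_cost addr_ge0 //.
  by rewrite divr_ge0 // mulr_ge0 ?sqr_ge0 //; have := quad_cst_ge18; lra.
by rewrite mulr_ge0 // ln_ge0 //; lra.
Qed.

(** One step of the backward induction: the drift delta gains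
h delta (a / t) (2 r - 1), and this gain has to cover the entropy cost of
delta, the decrease of r^2 / t as t grows, and the fluctuation cost 8 h a / t
(with the help of the logarithm when t is not small). *)
Lemma harnack_cost_recursion t h r delta : 0 < h -> h <= t -> 1 <= r ->
  delta = 3 * r / (t + h) ->
  harnack_cost t r - h * delta * (a / t * (2 * r - 1)) + 8 * h * (a / t)
    + h * delta ^+ 2 * D <= harnack_cost (t + h) r.
Proof.
move=> h0 ht r1 deltaE; rewrite /harnack_cost.
have t0 : 0 < t by lra.
have t'0 : 0 < t + h by lra.
have a0 : 0 < a by have := quad_cst_ge18; lra.
pose u := t^-1; pose v := (t + h)^-1.
have u0 : 0 < u by rewrite invr_gt0.
have v0 : 0 < v by rewrite invr_gt0.
have vu : v <= u by rewrite lef_pV2 ?posrE //; lra.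
have uvh : u - v = h * (u * v).
  by rewrite /u /v; field; rewrite !gt_eqF.
have lnd : h / (1 + (t + h)) <= ln (1 + (t + h)) - ln (1 + t).
  have p1 : 0 < 1 + (t + h) by lra.
  have p2 : 0 < 1 + t by lra.
  rewrite -[leRHS]opprB lerNr -ln_div ?posrE //.
  have -> : (1 + t) / (1 + (t + h)) = 1 + - (h / (1 + (t + h))).
    by field; rewrite gt_eqF.
  apply: le_ln1Dx; rewrite ltrN2 ltr_pdivrMr //; lra.
have key : 8 * u <= u * v + 144 / (1 + (t + h)).
  rewrite /u /v; set t' := t + h.
  have t't : t' <= 2 * t by rewrite /t'; lra.
  have t'1 : 0 < 1 + t' by rewrite /t'; lra.
  rewrite -subr_ge0.
  have -> : t^-1 * t'^-1 + 144 / (1 + t') - 8 * t^-1 =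
    ((1 + t') + 144 * t * t' - 8 * t' * (1 + t')) / (t * t' * (1 + t')).
    by field; rewrite !gt_eqF // /t'; lra.
  rewrite divr_ge0 ?mulr_ge0 ?(ltW t'1) ?(ltW t0) ?(ltW t'0) //.
  have : 72 * t' * t' <= 144 * t * t'.
    by rewrite ler_wpM2r ?(ltW t'0) //; lra.
  by have := sqr_ge0 (8 * t' - 1); rewrite /t'; nra.
have dE : delta = 3 * r * v by rewrite deltaE.
have bl : b * (h / (1 + (t + h))) <= b * (ln (1 + (t + h)) - ln (1 + t)).
  by rewrite ler_wpM2l.
have kl : a * h * (8 * u) <= a * h * (u * v + 144 / (1 + (t + h))).
  by rewrite ler_wpM2l // mulr_ge0 // ltW.
have e1 : h * delta * (a / t * (2 * r - 1)) = 3 * (a * h * (u * v)) * (r * (2 * r - 1)).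
  by rewrite dE -/u; ring.
have q0 : 0 <= a * h * (u * v).
  by apply: mulr_ge0; apply: mulr_ge0; exact: ltW.
have e2 : h * delta ^+ 2 * D <= a * h * (u * v) * r ^+ 2.
  rewrite dE [leLHS](_ : _ = a * h * r ^+ 2 * v * v); last by rewrite /a; ring.
  rewrite [leRHS](_ : _ = a * h * r ^+ 2 * v * u); last by ring.
  rewrite ler_wpM2l //.
  by rewrite mulr_ge0 ?(ltW v0) // mulr_ge0 ?sqr_ge0 // mulr_ge0 // ltW.
have e3 : a * r ^+ 2 / t - a * r ^+ 2 / (t + h) = a * h * (u * v) * r ^+ 2.
  by rewrite -mulrBr -/u -/v uvh; ring.
have e4 : (a * h * (u * v)) * (r ^+ 2 + 1) <= (a * h * (u * v)) * (2 * (r * (2 * r - 1))).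
  by rewrite ler_wpM2l //; nra.
have e5 : 0 <= (a * h * (u * v)) * (r * (2 * r - 1) - r ^+ 2).
  by rewrite mulr_ge0 //; nra.
move: e1 e2 e3 e4 e5 kl bl; rewrite -/u -/v /b.
move: (ln _) (ln _) ((1 + (t + h))^-1) (h * delta * _) (h * delta ^+ 2 * D).
move: (u * v) => uv L1 L2 w X Y.
lra.
Qed.

(** Induction on the number of steps.  Decompose the move of the pair of walkers
as staying put, moving the second one towards the first, and a half-lazy
step of both.  The first walker follows K, the second one the tilted law
Q, and [tilted_jensen] absorbs the change of law.  The difference to be
bounded never exceeds 2 M, so only pairs with a moderate cost matter;
for these, h delta is small once h is small compared with 1 / M, hence Q is
a probability.  The time is shifted by one step so that the cost of distinct
points is at least 2 M at the start. *)
Lemma log_harnack_discrete M h phi n x y : 0 < h -> h <= 8^-1 ->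
  72 * M * h <= a -> bounded_by M phi ->
  iter n (lazy nbr_avg h) phi x <= ln (iter n (lazy nbr_avg h) (fun z => expR (phi z)) y)
    + harnack_cost (n.+1%:R * h) (dist e x y)%:R.
Proof.
move=> h0 h8 hM phiM.
have mK : markov_op (lazy nbr_avg h).
  by apply: markov_lazy markov_nbr_avg _; apply/andP; split; lra.
have mKn m := markov_iter m mK.
pose g m z := iter m (lazy nbr_avg h) phi z.
pose E m z := iter m (lazy nbr_avg h) (fun z => expR (phi z)) z.
pose W m z := ln (E m z).
have E0 m z : 0 < E m z.
  by apply: lt_le_trans (markov_jensen_expR phi z (mKn m)); exact: expR_gt0.
have EW m z : expR (W m z) = E m z by apply: lnK; rewrite posrE.
have gW m z : g m z <= W m z.
  by rewrite -ler_expR EW; exact: (markov_jensen_expR phi z (mKn m)).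
have gM m z : - M <= g m z <= M.
  by rewrite -ler_norml; exact: (markov_bounded (mKn m) phiM).
have triv m u v : g m u - W m v <= 2 * M.
  have /andP[_ g1] := gM m u; have /andP[g2 _] := gM m v.
  by have := gW m v; lra.
have WS m z c : expR c <= lazy nbr_avg h (fun z => expR (W m z)) z -> c <= W m.+1 z.
  rewrite -[c <= _]ler_expR EW => /le_trans; apply.
  rewrite le_eqVlt; apply/orP; left; apply/eqP.
  by congr (lazy _ _ _ z); apply/funext => w; rewrite EW.
suff H m u v : g m u - W m v <= harnack_cost (m.+1%:R * h) (dist e u v)%:R.
  by rewrite -lerBlDl; exact: H.
have a0 : 0 < a by have := quad_cst_ge18; lra.
elim: m u v => [|m IH] u v.
  rewrite mul1r; case: (posnP (dist e u v)) => [|r0].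
    move=> /(dist_eq0 econ) <-; rewrite /g /W /E /= expRK subrr.
    by apply: harnack_cost_ge0; exact: ltW.
  apply: le_trans (triv 0%N u v) _; rewrite /harnack_cost.
  apply: (@le_trans _ _ (a / h)).
    rewrite ler_pdivlMr //; have : 0 <= M * h; last by lra.
    by rewrite mulr_ge0 ?(ltW h0) // (le_trans _ (phiM u)).
  rewrite -[leLHS]addr0 lerD //; last first.
    by rewrite mulr_ge0 // ln_ge0 //; lra.
  rewrite ler_wpM2r ?invr_ge0 ?(ltW h0) // ler_peMr ?(ltW a0) //.
  by rewrite exprn_ege1 // ler1n.
set t := m.+1%:R * h in IH.
have tS : m.+2%:R * h = t + h by rewrite -natr1 mulrDl mul1r.
have th : h <= t by rewrite ler_peMl ?(ltW h0) // ler1n.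
have t0 : 0 < t by lra.
have t'0 : 0 < t + h by lra.
rewrite tS; case: (posnP (dist e u v)) => [duv|r0].
  rewrite duv -(dist_eq0 econ duv).
  have := markov_le mK (f := g m) (g := fun z => W m z + harnack_cost t 0) _ u.
  rewrite (markovD mK) (markov_cst mK) => /(_ _)/wrap[].
    by move=> z; rewrite -lerBlDl; have := IH z z; rewrite distxx.
  move=> gu; have Wu : lazy nbr_avg h (W m) u <= W m.+1 u.
    by apply: WS; exact: markov_jensen_expR.
  have hc : harnack_cost t 0 <= harnack_cost (t + h) 0.
    rewrite /harnack_cost expr0n /= !mulr0 !mul0r !add0r ler_wpM2l //.
    by rewrite ler_ln ?posrE; lra.
  by move: gu; rewrite -[lazy nbr_avg h (g m) u]/(g m.+1 u); lra.
set r : R := (dist e u v)%:R.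
have r1 : 1 <= r by rewrite ler1n.
(* A cost above 2 M is vacuous. *)
have [big|small] := leP (2 * M) (harnack_cost (t + h) r).
  exact: le_trans (triv _ _ _) big.
(* Three times the drift that would merge the walkers just in time. *)
pose delta := 3 * r / (t + h).
have de0 : 0 <= delta by rewrite divr_ge0 ?mulr_ge0 ?ltW //; lra.
have hde : h * delta <= 2^-1.
  have hd0 : 0 <= h * delta by rewrite mulr_ge0 // ltW.
  have ar : a * r ^+ 2 / (t + h) <= 2 * M.
    apply: le_trans (ltW small); rewrite /harnack_cost lerDl mulr_ge0 //.
    by apply: ln_ge0; lra.
  have hr : h / (t + h) <= 1 by rewrite ler_pdivrMr //; lra.
  have : a * (h * delta) ^+ 2 <= a * (2^-1) ^+ 2.
    have -> : a * (h * delta) ^+ 2 =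
        9 * h * (h / (t + h)) * (a * r ^+ 2 / (t + h)) by rewrite /delta; ring.
    apply: (@le_trans _ _ (9 * h * 1 * (2 * M))); last by rewrite expr2; lra.
    have h9 : 0 <= 9 * h by rewrite mulr_ge0 // ltW.
    apply: ler_pM => //; last by rewrite ler_wpM2l.
      by rewrite mulr_ge0 // divr_ge0 ?(ltW h0) // ltW.
    by rewrite divr_ge0 ?(ltW t'0) // mulr_ge0 ?sqr_ge0 // ltW.
  by rewrite ler_pM2l // ler_pXn2r // nnegrE invr_ge0.
have [v' vv' dv'] : exists2 v', e v v' & dist e u v' = (dist e u v).-1.
  by apply: (dist_pred esym econ); rewrite (prednK r0).
have dv'R : (dist e u v')%:R = r - 1.
  by rewrite dv' -subn1 natrB.
have tj := @tilted_jensen h delta (W m) v v' _ de0 hde vv'.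
have {}tj := WS _ _ _ (tj _).
have KE f z : lazy nbr_avg h f z = (1 - 2 * h) * f z + 2 * h * lazy nbr_avg one_half f z.
  exact: lazy_split.
have hs := @half_step_quadratic (a / t) (b * ln (1 + t)) (g m) (W m) u v.
have {}hs : lazy nbr_avg one_half (g m) u - lazy nbr_avg one_half (W m) v <=
    harnack_cost t r + 4 * (a / t).
  have -> : harnack_cost t r = a / t * r ^+ 2 + b * ln (1 + t).
    by rewrite /harnack_cost mulrAC.
  apply: hs; first by rewrite divr_ge0 ?ltW.
  by move=> u' v'' ; have := IH u' v''; rewrite /harnack_cost [a * _ / t]mulrAC.
have i1 := IH u v; rewrite -/r in i1.
have i2 := IH u v'; rewrite dv'R in i2.
have i2' : harnack_cost t (r - 1) = harnack_cost t r - a / t * (2 * r - 1).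
  by rewrite /harnack_cost; ring.
have rec := @harnack_cost_recursion t h r delta h0 th r1 erefl.
have {}tj := tj _; rewrite KE in tj.
rewrite -[g m.+1 u]/(lazy nbr_avg h (g m) u) KE.
have c1 : 0 <= 1 - 2 * h - h * delta by lra.
have c2 : 0 <= h * delta by rewrite mulr_ge0 // ltW.
have c3 : 0 <= 2 * h by lra.
have j1 := ler_wpM2l c1 i1.
have j2 := ler_wpM2l c2 i2.
have j3 := ler_wpM2l c3 hs.
rewrite i2' in j2.
have {}tj : (1 - 2 * h) * W m v + 2 * h * lazy nbr_avg one_half (W m) v +
  h * delta * (W m v' - W m v) - h * delta ^+ 2 * D <= W m.+1 v.
  by apply: tj; apply/andP; split; lra.
move: tj j1 j2 j3 rec.
move: (lazy nbr_avg one_half (g m) u) (lazy nbr_avg one_half (W m) v)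
  (W m.+1 v) (W m v) (W m v')
  (g m u) (harnack_cost t r) (harnack_cost (t + h) r) (a / t)
  (h * delta ^+ 2 * D) (h * delta).
by move=> *; lra.
Qed.

End RandomWalk.

(** * The heat semigroup of a Markov operator *)

Section HeatSemigroup.
Variables (R : realType) (V : choiceType) (A : (V -> R) -> V -> R).
Hypothesis mA : markov_op A.
Hypothesis finA : forall x, exists (s : seq V) (w : V -> R),
  forall f, A f x = \sum_(z <- s) w z * f z.
Implicit Types (f g : V -> R) (x : V) (s t h M N : R).

Definition heat t f x := poisson_avg t (fun k => iter k A f x).

Lemma iter_bounded M f x : bounded_by M f ->
  bounded_seq M (fun k => iter k A f x).
Proof. by move=> fM k; exact: (markov_bounded (markov_iter k mA) fM). Qed.

Lemma heat_bounded t M f : 0 <= t -> bounded_by M f -> bounded_by M (heat t f).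
Proof.
by move=> t0 fM x; apply: poisson_avg_bounded => //; exact: iter_bounded.
Qed.

Lemma heatD t M N f g x : bounded_by M f -> bounded_by N g ->
  heat t (fun z => f z + g z) x = heat t f x + heat t g x.
Proof.
move=> fM gN; rewrite /heat.
rewrite -(poisson_avgD _ (iter_bounded x fM) (iter_bounded x gN)).
by congr poisson_avg; apply/funext => k; rewrite (markovD (markov_iter k mA)).
Qed.

Lemma heatZ t M c f x : bounded_by M f ->
  heat t (fun z => c * f z) x = c * heat t f x.
Proof.
move=> fM; rewrite /heat -(poisson_avgZ _ _ (iter_bounded x fM)).
by congr poisson_avg; apply/funext => k; rewrite (markovZ (markov_iter k mA)).
Qed.

Lemma heat_cst t c x : heat t (fun=> c) x = c.
Proof.
rewrite -[RHS](poisson_avg_cst t); congr poisson_avg.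
by apply/funext => k; rewrite (markov_cst (markov_iter k mA)).
Qed.

Lemma heat_le t M N f g x : 0 <= t -> bounded_by M f -> bounded_by N g ->
  (forall z, f z <= g z) -> heat t f x <= heat t g x.
Proof.
move=> t0 fM gN fg.
apply: (poisson_avg_le t0 (iter_bounded x fM) (iter_bounded x gN)) => k.
exact: (markov_le (markov_iter k mA)).
Qed.

Lemma heat_ge0 t M f x : 0 <= t -> bounded_by M f -> (forall z, 0 <= f z) ->
  0 <= heat t f x.
Proof.
move=> t0 fM f0; apply: (poisson_avg_ge0 t0 (iter_bounded x fM)) => k.
by rewrite -(markov_cst (markov_iter k mA) 0 x) (markov_le (markov_iter k mA)).
Qed.

Lemma heat_ge_self t M f x : 0 <= t -> bounded_by M f -> (forall z, 0 <= f z) ->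
  expR (- t) * f x <= heat t f x.
Proof.
move=> t0 fM f0.
have := poisson_avg_ge_term 0 t0 (iter_bounded x fM).
rewrite expr0 fact0 divr1 mul1r; apply => k.
by rewrite -(markov_cst (markov_iter k mA) 0 x) (markov_le (markov_iter k mA)).
Qed.

(** Iterates of A commute with the Poisson average because A is a finite sum at
every point. *)
Lemma poisson_avg_sum t M (s : seq V) (w : V -> R) (F : V -> nat -> R) :
  (forall z, bounded_seq M (F z)) ->
  poisson_avg t (fun k => \sum_(z <- s) w z * F z k) =
  \sum_(z <- s) w z * poisson_avg t (F z).
Proof.
move=> FM; suff [] : (exists B, bounded_seq B (fun k => \sum_(z <- s) w z * F z k)) /\
  poisson_avg t (fun k => \sum_(z <- s) w z * F z k) =
  \sum_(z <- s) w z * poisson_avg t (F z) by [].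
elim: s => [|z s [[B sB] IH]].
  have -> : (fun k => \sum_(z <- [::]) w z * F z k) = fun=> 0.
    by apply/funext => k; rewrite big_nil.
  by rewrite big_nil poisson_avg_cst; split => //; exists 0 => k; rewrite normr0.
have zB : bounded_seq (`|w z| * M) (fun k => w z * F z k).
  by move=> k; rewrite normrM ler_wpM2l // FM.
have -> : (fun k => \sum_(z <- z :: s) w z * F z k) =
    fun k => w z * F z k + \sum_(z <- s) w z * F z k.
  by apply/funext => k; rewrite big_cons.
split; first by exists (`|w z| * M + B); exact: bounded_seqD.
by rewrite (poisson_avgD _ zB sB) (poisson_avgZ _ _ (FM z)) IH big_cons.
Qed.

Lemma iter_heat t M f i x : 0 <= t -> bounded_by M f ->
  iter i A (heat t f) x = poisson_avg t (fun j => iter (i + j) A f x).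
Proof.
move=> t0 fM; elim: i x => [|i IH] x /=.
  by congr poisson_avg.
have -> : iter i A (heat t f) =
    fun z => poisson_avg t (fun j => iter (i + j) A f z) by apply/funext.
have [s [w AE]] := finA x.
rewrite AE -(@poisson_avg_sum _ M) => [|z k].
  by congr poisson_avg; apply/funext => k; rewrite -AE.
exact: (markov_bounded (markov_iter _ mA) fM).
Qed.

Lemma heat_semigroup s t M f x : 0 <= s -> 0 <= t -> bounded_by M f ->
  heat s (heat t f) x = heat (s + t) f x.
Proof.
move=> s0 t0 fM; rewrite /heat -(poisson_avg_semigroup s0 t0 (iter_bounded x fM)).
by congr poisson_avg; apply/funext => i; exact: (iter_heat i x t0 fM).
Qed.

Lemma heat_euler h M f x : 0 <= h -> bounded_by M f ->
  `|heat h f x - lazy A h f x| <= 3 * h ^+ 2 * M.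
Proof. by move=> h0 fM; exact: (poisson_avg_euler h0 (iter_bounded x fM)). Qed.

Lemma heat_euler_iter h M f n x : 0 <= h <= 1 -> bounded_by M f ->
  `|iter n (lazy A h) f x - heat (n%:R * h) f x| <= n%:R * (3 * h ^+ 2 * M).
Proof.
move=> /[dup] h01 /andP[h0 h1] fM; have mK := markov_lazy mA h01.
elim: n x => [|n IH] x.
  rewrite mul0r mul0r normr_le0 subr_eq0; apply/eqP.
  have := poisson_avg_euler (lexx 0) (iter_bounded x fM).
  rewrite expr0n /= mulr0 mul0r normr_le0 subr0 mul1r mul0r addr0 subr_eq0.
  by move=> /eqP E; exact: esym E.
set t := n%:R * h in IH.
have t0 : 0 <= t by rewrite mulr_ge0.
have tS : n.+1%:R * h = h + t by rewrite -nat1r mulrDl mul1r.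
have hM := heat_bounded t0 fM.
rewrite tS -(heat_semigroup x h0 t0 fM) /=.
have := heat_euler x h0 hM; rewrite distrC => e1.
have : `|lazy A h (fun z => iter n (lazy A h) f z - heat t f z) x| <=
    n%:R * (3 * h ^+ 2 * M) by exact: (markov_bounded mK IH).
rewrite (markovB _ _ _ mK) => e2.
have -> : n.+1%:R * (3 * h ^+ 2 * M) = n%:R * (3 * h ^+ 2 * M) + 3 * h ^+ 2 * M.
  by rewrite -natr1 mulrDl mul1r.
rewrite -(subrKA (lazy A h (heat t f) x)).
by rewrite (le_trans (ler_normD _ _)) // lerD.
Qed.

(** Telescoping: each of the n steps of size t / n contributes an error
O((t / n)^2) by [heat_euler]. *)
Lemma heat_cvg t M f x : 0 <= t -> bounded_by M f ->
  (fun n => iter n.+1 (lazy A (t / n.+1%:R)) f x) @ \oo --> heat t f x.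
Proof.
move=> t0 fM; have M0 : 0 <= M by rewrite (le_trans _ (fM x)).
have bnd : \forall n \near \oo,
    `|iter n.+1 (lazy A (t / n.+1%:R)) f x - heat t f x| <=
    (3 * t ^+ 2 * M) * n.+1%:R^-1.
  near=> n.
  have n0 : 0 < n.+1%:R :> R by rewrite ltr0n.
  have := @heat_euler_iter (t / n.+1%:R) M f n.+1 x.
  have -> : n.+1%:R * (t / n.+1%:R) = t by rewrite mulrC divfK ?gt_eqF.
  move=> /(_ _ fM)/le_trans; apply; last first.
    rewrite le_eqVlt; apply/orP; left; apply/eqP.
    by field; rewrite -[X in 1 + X]/(n%:R) nat1r gt_eqF.
  rewrite divr_ge0 ?(ltW n0) //= ler_pdivrMr // mul1r.
  rewrite (@le_trans _ _ n%:R) ?ler_nat //.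
  by near: n; exact: nbhs_infty_ger.
have c0 : (fun n => (3 * t ^+ 2 * M) * n.+1%:R^-1) @ \oo --> (0 : R).
  rewrite -[X in _ --> X](mulr0 (3 * t ^+ 2 * M)).
  by apply: cvgMl_tmp; exact: cvg_harmonic.
apply/cvgrPdist_le => eps eps0.
move/cvgrPdist_le: c0 => /(_ _ eps0).
apply: filterS2 bnd => n; rewrite sub0r normrN distrC => le1 le2.
by apply: le_trans le1 (le_trans (ler_norm _) le2).
Unshelve. all: by end_near. Qed.

End HeatSemigroup.

(** * Log-Harnack inequality and concentration for the heat semigroup *)

Section GraphHeat.
Variables (R : realType) (V : choiceType) (e : rel V) (d : nat).
Hypothesis G : curved_graph R e d.
Implicit Types (f g : V -> R) (x y z : V) (t h M c : R).

Local Notation P := (@nbr_avg R V e).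
Local Notation T := (heat P).
Local Notation a := (quad_cst R d).
Local Notation b := (log_cst R d).

Let mP : markov_op P := markov_nbr_avg G.

Let finP := @nbr_avg_finite R V e.

(** Inequalities between Euler schemes with small steps pass to the heat
semigroup. *)
Lemma heat_le_limit t M N f g x y c (F : R -> R) : 0 < t ->
  bounded_by M f -> bounded_by N g -> continuous F ->
  (exists2 h0, 0 < h0 & forall n h, 0 < h <= h0 -> n%:R * h = t ->
    iter n (lazy P h) f x <= F (iter n (lazy P h) g y) + c) ->
  T t f x <= F (T t g y) + c.
Proof.
move=> t0 fM gN Fc [h0 h00 H].
have cf := @heat_cvg _ _ _ mP finP t M f x (ltW t0) fM.
have cg := @heat_cvg _ _ _ mP finP t N g y (ltW t0) gN.
have cF : (fun n => F (iter n.+1 (lazy P (t / n.+1%:R)) g y) + c) @ \oo -->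
    F (T t g y) + c.
  apply: cvgD; last exact: cvg_cst.
  exact: (continuous_cvg _ (Fc _) cg).
apply: (ler_cvg_to cf cF); near=> n.
have n0 : 0 < n.+1%:R :> R by rewrite ltr0n.
apply: H; last by rewrite mulrC divfK ?gt_eqF.
rewrite divr_gt0 //= ler_pdivrMr // -ler_pdivrMl //.
rewrite (@le_trans _ _ n%:R) ?ler_nat //.
by near: n; exact: nbhs_infty_ger.
Unshelve. all: by end_near. Qed.

(** The value 1 + 2 t leaves room for the time shift of [harnack_cost]. *)
Definition harnack_gap t (r : nat) : R := a * r%:R ^+ 2 / t + b * ln (1 + 2 * t).

Lemma expR_bounded M f : bounded_by M f -> bounded_by (expR M) (fun z => expR (f z)).
Proof.
move=> fM z; rewrite ger0_norm ?expR_ge0 // ler_expR.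
exact: le_trans (ler_norm _) (fM z).
Qed.

Lemma log_harnack t M phi x y : 0 < t -> bounded_by M phi ->
  expR (T t phi x - harnack_gap t (dist e x y)) <=
  T t (fun z => expR (phi z)) y.
Proof.
move=> t0 phiM; set k := harnack_gap t _.
have M0 : 0 <= M by rewrite (le_trans _ (phiM x)).
have a0 : 0 < a by have := quad_cst_ge18 G; lra.
suff : - T t (fun z => expR (phi z)) y <= - expR (T t phi x - k) + 0.
  by rewrite addr0 lerN2.
have -> : - T t (fun z => expR (phi z)) y = T t (fun z => - 1 * expR (phi z)) y.
  by rewrite (heatZ mP _ _ _ (expR_bounded phiM)) mulN1r.
apply: (@heat_le_limit t (expR M) M _ phi y x 0 (fun u => - expR (u - k))) => //.
- by move=> z; rewrite mulN1r normrN; exact: expR_bounded.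
- move=> u; apply: cvgN; apply: (continuous_cvg _ (@continuous_expR R (u - k))).
  by apply: cvgB; [exact: cvg_id|exact: cvg_cst].
- exists (Num.min (8^-1) (Num.min t (a / (72 * M + 1)))).
    by rewrite !lt_min invr_gt0 t0 divr_gt0 //; lra.
  move=> n h; rewrite !le_min => /andP[h0 /andP[h8 /andP[ht hM]]] nh.
  have hM' : 72 * M * h <= a.
    by move: hM; rewrite ler_pdivlMr; nra.
  have mK : markov_op (lazy P h) by apply: (markov_lazy mP); lra.
  rewrite addr0 (markovZ (markov_iter n mK)) mulN1r lerN2.
  have := log_harnack_discrete G n x y h0 h8 hM' phiM.
  set u := iter n _ _ x; set v := iter n _ _ y => uv.
  have v0 : 0 < v.
    by apply: lt_le_trans (markov_jensen_expR phi y (markov_iter n mK)); exact: expR_gt0.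
  rewrite -[leRHS](@lnK _ v) ?posrE // ler_expR lerBlDr (le_trans uv) // lerD2l.
  rewrite /k /harnack_cost /harnack_gap -natr1 mulrDl mul1r nh lerD //.
    rewrite ler_wpM2l //; first by rewrite mulr_ge0 ?sqr_ge0 // ltW.
    by rewrite lef_pV2 ?posrE //; lra.
  by rewrite ler_wpM2l ?(log_cst_ge0 G) // ler_ln ?posrE; lra.
Qed.

Lemma natr_mulSl n c : n.+1%:R * c = n%:R * c + c.
Proof. by rewrite -natr1 mulrDl mul1r. Qed.

Lemma lip_neighbor f x z : lip e 1 f -> e x z -> -1 <= f z - f x <= 1.
Proof.
move=> fL xz; have d1 : (dist e x z)%:R <= 1 :> R by rewrite lern1 (dist_adj xz).
have := fL x z; have := fL z x; rewrite !mul1r (distC (graph_sym G) (graph_con G) z x).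
by move=> A B; apply/andP; split; lra.
Qed.

Lemma lazy_iter_lip n h f : 0 <= h <= one_half R -> lip e 1 f -> lip e 1 (iter n (lazy P h) f).
Proof. by move=> h0 fL; elim: n => //= n; exact: (lazy_lip G). Qed.

Lemma expR_le_quad (u : R) : u <= 2^-1 -> expR u <= 1 + u + 2 * u ^+ 2.
Proof.
move=> u2; have u1 : 0 < 1 - u by lra.
have : 1 - u <= (expR u)^-1 by rewrite -expRN; exact: expR_ge1Dx.
rewrite -[leLHS]invrK lef_pV2 ?posrE ?invr_gt0 ?expR_gt0 // => /le_trans; apply.
rewrite -[leLHS]mul1r ler_pdivrMr //.
have -> : (1 + u + 2 * u ^+ 2) * (1 - u) = 1 + u ^+ 2 * (1 - 2 * u) by ring.
by rewrite lerDl mulr_ge0 ?sqr_ge0 //; lra.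
Qed.

(** A Lipschitz function moves by at most 1, and only with probability h. *)
Lemma lazy_exp_moment h l f x : 0 <= h <= 1 -> `|l| <= 2^-1 -> lip e 1 f ->
  lazy P h (fun z => expR (l * f z)) x <=
  expR (l * lazy P h f x + 2 * h * l ^+ 2).
Proof.
move=> /andP[h0 h1] l2 fL.
have mK : markov_op (lazy P h) by apply: (markov_lazy mP); rewrite h0 h1.
have -> : (fun z => expR (l * f z)) = fun z => expR (l * f x) * expR (l * (f z - f x)).
  by apply/funext => z; rewrite -expRD -mulrDr subrKC.
rewrite (markovZ mK).
pose L z := 1 + l * (f z - f x) + 2 * l ^+ 2.
have : P (fun z => expR (l * (f z - f x))) x <= P L x.
  apply: (nbr_avg_le_local G) => z xz; have /andP[D1 D2] := lip_neighbor fL xz.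
  have aD : `|f z - f x| <= 1 by rewrite ler_norml D1.
  have nl : `|l * (f z - f x)| <= `|l|.
    by rewrite normrM ler_piMr.
  apply: le_trans (expR_le_quad _) _.
    by rewrite (le_trans (ler_norm _)) // (le_trans nl).
  rewrite /L lerD2l ler_wpM2l // -(real_normK (num_real l)).
  rewrite -(real_normK (num_real (l * _))) ler_pXn2r // nnegrE //.
have -> : P L x = 1 + l * (P f x - f x) + 2 * l ^+ 2.
  rewrite /L (markovD mP) (markovD mP) !(markov_cst mP) (markovZ mP).
  by rewrite (markovB _ _ _ mP) (markov_cst mP).
move=> PL; apply: (@le_trans _ _ (expR (l * f x) * (1 + h * (l * (P f x - f x) + 2 * l ^+ 2)))).
  rewrite ler_wpM2l ?expR_ge0 // /lazy subrr mulr0 expR0.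
  by have := ler_wpM2l h0 PL; lra.
have -> : l * lazy P h f x + 2 * h * l ^+ 2 = l * f x + h * (l * (P f x - f x) + 2 * l ^+ 2).
  by rewrite /lazy; ring.
by rewrite expRD ler_wpM2l ?expR_ge0 // expR_ge1Dx.
Qed.

Lemma lazy_iter_exp_moment n h l f x : 0 <= h <= one_half R -> `|l| <= 2^-1 -> lip e 1 f ->
  iter n (lazy P h) (fun z => expR (l * f z)) x <=
  expR (l * iter n (lazy P h) f x + n%:R * (2 * h * l ^+ 2)).
Proof.
move=> hh l2; have h01 : 0 <= h <= 1.
  by move: hh; rewrite /one_half => /andP[-> ?]; lra.
have mK := markov_lazy mP h01.
elim: n f x => [|n IH] f x fL; first by rewrite mul0r addr0.
rewrite !iterSr.
have := markov_le (markov_iter n mK) (fun z => lazy_exp_moment z h01 l2 fL) x.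
move=> /le_trans; apply.
have -> : (fun z => expR (l * lazy P h f z + 2 * h * l ^+ 2)) =
   fun z => expR (2 * h * l ^+ 2) * expR (l * lazy P h f z).
  by apply/funext => z; rewrite addrC expRD.
rewrite (markovZ (markov_iter n mK)) (natr_mulSl n) addrA expRD mulrC.
rewrite ler_wpM2r ?expR_ge0 //; apply: IH; exact: (lazy_lip G).
Qed.

(** Sub-Gaussian concentration: T_(t-u) f (X_u) is a martingale whose
increments are bounded because T_(t-u) f is again 1-Lipschitz. *)
Lemma heat_exp_moment t M l f x : 0 < t -> `|l| <= 2^-1 -> bounded_by M f ->
  lip e 1 f ->
  T t (fun z => expR (l * f z)) x <= expR (l * T t f x + 2 * t * l ^+ 2).
Proof.
move=> t0 l2 fM fL.
have lfM : bounded_by (`|l| * M) (fun z => l * f z).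
  by move=> z; rewrite normrM ler_wpM2l.
rewrite -[leRHS]addr0.
apply: (@heat_le_limit t _ M _ f x x 0 (fun u => expR (l * u + 2 * t * l ^+ 2)) t0
  (expR_bounded lfM) fM).
- move=> u; apply: (continuous_cvg _ (@continuous_expR R (l * u + 2 * t * l ^+ 2))).
  by apply: cvgD; [apply: cvgMl_tmp; exact: cvg_id|exact: cvg_cst].
- exists (one_half R); first by rewrite /one_half invr_gt0.
  move=> n h /andP[h0 hh] nh; rewrite addr0 -nh.
  rewrite (_ : 2 * _ * _ = n%:R * (2 * h * l ^+ 2)); last by ring.
  by apply: lazy_iter_exp_moment => //; rewrite hh ltW.
Qed.

Lemma lazy_square h f x : 0 <= h <= 1 -> lip e 1 f ->
  lazy P h (fun z => f z ^+ 2) x <= (lazy P h f x) ^+ 2 + h.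
Proof.
move=> /andP[h0 h1] fL.
pose L z := f x ^+ 2 + (2 * f x) * (f z - f x) + 1.
have : P (fun z => f z ^+ 2) x <= P L x.
  apply: (nbr_avg_le_local G) => z xz; have /andP[D1 D2] := lip_neighbor fL xz.
  by rewrite /L; nra.
have -> : P L x = f x ^+ 2 + 2 * f x * (P f x - f x) + 1.
  rewrite /L (markovD mP) (markovD mP) !(markov_cst mP) (markovZ mP).
  by rewrite (markovB _ _ _ mP) (markov_cst mP).
move=> PL; have := ler_wpM2l h0 PL; rewrite /lazy.
have := sqr_ge0 (h * (P f x - f x)).
move: (P _ x) (P f x) (f x) => u v w A B.
by lra.
Qed.

(** The variance of f (X_t) is at most t, by the same martingale. *)
Lemma heat_square t M f x : 0 < t -> bounded_by M f -> lip e 1 f ->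
  T t (fun z => f z ^+ 2) x <= (T t f x) ^+ 2 + t.
Proof.
move=> t0 fM fL.
apply: (@heat_le_limit t (M ^+ 2) M _ f x x t (fun u => u ^+ 2)) => //.
- by move=> z; rewrite normrX ler_pXn2r ?nnegrE // (le_trans _ (fM z)).
- by move=> u; apply: cvgM; exact: cvg_id.
- exists (one_half R); first by rewrite /one_half invr_gt0.
  move=> n h /andP[h0 hh]; have h01 : 0 <= h <= 1 by move: hh; rewrite /one_half; lra.
  have mK := markov_lazy mP h01.
  have hh' : 0 <= h <= one_half R by rewrite hh ltW.
  move=> <-; elim: n f fL {fM} => [|n IH] g gL; first by rewrite mul0r addr0.
  rewrite !iterSr.
  have := markov_le (markov_iter n mK) (fun z => lazy_square z h01 gL) x.
  move=> /le_trans; apply; rewrite (markovD (markov_iter n mK)) (markov_cst (markov_iter n mK)).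
  rewrite (natr_mulSl n) addrA lerD2r; apply: IH.
  exact: (lazy_lip G).
Qed.

Lemma heat_drift t M f x : 0 < t -> bounded_by M f -> lip e 1 f ->
  T t f x <= f x + t.
Proof.
move=> t0 fM fL.
have fxM : bounded_by `|f x| (fun _ : V => f x) by move=> z.
have := @heat_le_limit t M `|f x| f (fun=> f x) x x t id t0 fM fxM.
rewrite (heat_cst mP); apply; first by move=> u; exact: cvg_id.
exists (one_half R); first by rewrite /one_half invr_gt0.
move=> n h /andP[h0 hh] <-; have h01 : 0 <= h <= 1 by move: hh; rewrite /one_half; lra.
have mK := markov_lazy mP h01.
rewrite (markov_cst (markov_iter n mK)).
elim: n => [|n IH]; first by rewrite mul0r addr0.
have gL : lip e 1 (iter n (lazy P h) f) by apply: lazy_iter_lip => //; rewrite hh ltW.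
rewrite /=; set g := iter n _ _ in gL IH *.
have : P g x <= P (fun=> g x + 1) x.
  apply: (nbr_avg_le_local G) => z xz; have /andP[D1 D2] := lip_neighbor gL xz; lra.
rewrite (markov_cst mP) => Pg; have := ler_wpM2l (ltW h0) Pg.
by rewrite (natr_mulSl n) /lazy; lra.
Qed.

End GraphHeat.

(** * The heat kernel *)

Section HeatKernel.
Variables (R : realType) (V : choiceType) (e : rel V) (d : nat).
Hypothesis G : curved_graph R e d.
Implicit Types (f g : V -> R) (x y z : V) (t h M c : R) (s : seq V).

Local Notation P := (@nbr_avg R V e).
Local Notation T := (heat P).
Local Notation a := (quad_cst R d).
Local Notation b := (log_cst R d).
Local Notation m x := ((deg e x)%:R).

Let mP : markov_op P := markov_nbr_avg G.
Let esym := graph_sym G.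
Let econ := graph_con G.

Definition hk t x y : R := T t (ind R y) x.

Lemma heat_kernelE t x y : heat_kernel e t x y = hk t x y.
Proof.
rewrite /heat_kernel /hk /heat /poisson_avg; congr (_ * _); congr (limn (series _)).
by apply/funext => k; rewrite (rw_kernel_powE G).
Qed.

Lemma ind_bounded y : bounded_by 1 (ind R y).
Proof. by move=> z; rewrite /ind; case: eqP; rewrite ?normr1 ?normr0. Qed.

Lemma ind_ge0 y z : 0 <= ind R y z.
Proof. by rewrite /ind ler0n. Qed.

Lemma hk_ge0 t x y : 0 <= t -> 0 <= hk t x y.
Proof. by move=> t0; apply: (heat_ge0 mP x t0 (@ind_bounded y) (@ind_ge0 y)). Qed.

Lemma hk_le1 t x y : 0 <= t -> hk t x y <= 1.
Proof.
by move=> t0; apply: le_trans (ler_norm _) _; exact: (heat_bounded mP t0 (@ind_bounded y)).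
Qed.

Lemma hk_diag t x : 0 <= t -> expR (- t) <= hk t x x.
Proof.
move=> t0; have := heat_ge_self mP x t0 (@ind_bounded x) (@ind_ge0 x).
by rewrite {1}/ind eqxx mulr1.
Qed.

Definition restr s f z : R := if z \in s then f z else 0.

Lemma restr_bounded s f : bounded_by (\sum_(z <- s) `|f z|) (restr s f).
Proof.
move=> z; rewrite /restr; case: ifPn => zs; last by rewrite normr0 sumr_ge0.
by rewrite (big_rem z) //= lerDl sumr_ge0.
Qed.

Lemma heat_restr t s f x : uniq s ->
  T t (restr s f) x = \sum_(z <- s) hk t x z * f z.
Proof.
elim: s => [_|z s IH /= /andP[zs us]].
  by rewrite big_nil -[RHS](heat_cst mP t 0 x).
rewrite big_cons -IH //.
have -> : restr (z :: s) f = fun w => f z * ind R z w + restr s f w.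
  apply/funext => w; rewrite /restr /ind inE; case: eqP => [->|_] /=.
    by rewrite mulr1 (negbTE zs) addr0.
  by rewrite mulr0 add0r.
have b1 : bounded_by (`|f z|) (fun w => f z * ind R z w).
  by move=> w; rewrite normrM ler_piMr // ind_bounded.
rewrite (heatD mP _ _ b1 (@restr_bounded s f)).
by rewrite (heatZ mP _ _ _ (@ind_bounded z)) [hk _ _ _ * _]mulrC.
Qed.

Lemma restr1_bounded s : bounded_by 1 (restr s (fun=> 1)).
Proof. by move=> z; rewrite /restr; case: ifP; rewrite ?normr1 ?normr0. Qed.

Lemma sum_hk t s x : uniq s -> \sum_(z <- s) hk t x z = T t (restr s (fun=> 1)) x.
Proof. by move=> us; rewrite heat_restr //; apply: eq_bigr => z _; rewrite mulr1. Qed.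

Lemma sum_hk_le1 t s x : 0 <= t -> uniq s -> \sum_(z <- s) hk t x z <= 1.
Proof.
move=> t0 us; rewrite sum_hk //; apply: le_trans (ler_norm _) _.
exact: (heat_bounded mP t0 (@restr1_bounded s)).
Qed.

Lemma markov_sum A (s : seq V) (F : V -> V -> R) x : markov_op A ->
  A (fun w => \sum_(z <- s) F z w) x = \sum_(z <- s) A (F z) x.
Proof.
move=> mA; elim: s => [|z s IH].
  rewrite big_nil -[RHS](markov_cst mA 0 x).
  by congr (A _ x); apply/funext => w; rewrite big_nil.
rewrite big_cons -IH -(markovD mA).
by congr (A _ x); apply/funext => w; rewrite big_cons.
Qed.

(** Detailed balance. *)
Lemma nbr_avg_iter_sym k x y : m x * iter k P (ind R y) x = m y * iter k P (ind R x) y.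
Proof.
elim: k x y => [|k IH] x y.
  by rewrite /= /ind eq_sym; case: eqP => [->|]; rewrite ?mulr0.
rewrite [in RHS]iterSr [in LHS]iterS.
have -> : P (ind R x) = fun w => \sum_(z <- nbrs e x) (m z)^-1 * ind R z w.
  apply/funext => w; rewrite {1}/nbr_avg.
  have [wx|wx] := boolP (w \in nbrs e x); last first.
    rewrite !big_seq !big1 ?mulr0 // => z zx; rewrite /ind.
      by case: eqP => [wz|_]; [rewrite wz zx in wx|rewrite mulr0].
    case: eqP => // zx'; rewrite zx' in zx; case/negP: wx.
    by rewrite (in_nbrs G) esym -(in_nbrs G).
  rewrite (big_fsetD1 x) /=; last by rewrite (in_nbrs G) esym -(in_nbrs G).
  rewrite [RHS](big_fsetD1 w) //= /ind !eqxx mulr1.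
  rewrite !big_seq !big1 ?addr0 ?mulr1 // => z; rewrite in_fsetD1 => /andP[zx _].
    by rewrite eq_sym (negbTE zx) mulr0.
  by rewrite (negbTE zx).
rewrite (markov_sum _ _ _ (markov_iter k mP)) mulr_sumr.
rewrite /nbr_avg mulrA mulfV ?mul1r ?(degR_neq0 G) //.
apply: eq_bigr => z _; rewrite (markovZ (markov_iter k mP)).
by rewrite mulrCA -IH mulKf ?(degR_neq0 G).
Qed.

Lemma hk_sym t x y : m x * hk t x y = m y * hk t y x.
Proof.
rewrite /hk /heat -!(poisson_avgZ _ _ (iter_bounded mP _ (@ind_bounded _))).
by congr poisson_avg; apply/funext => k; exact: nbr_avg_iter_sym.
Qed.

(** Truncation makes the distance bounded, as the heat semigroup requires. *)
Definition trunc_dist x (N : nat) y : R := (minn (dist e x y) N)%:R.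

Lemma trunc_dist_bounded x N : bounded_by N%:R (trunc_dist x N).
Proof. by move=> y; rewrite normr_nat ler_nat geq_minr. Qed.

Lemma trunc_distxx x N : trunc_dist x N x = 0.
Proof. by rewrite /trunc_dist distxx min0n. Qed.

Lemma trunc_dist_ge0 x N y : 0 <= trunc_dist x N y.
Proof. by rewrite ler0n. Qed.

Lemma trunc_dist_lip x N : lip e 1 (trunc_dist x N).
Proof.
move=> y z; rewrite mul1r lerBlDr -natrD ler_nat.
have := dist_triangle econ x z y; rewrite (distC esym econ z y); lia.
Qed.

Lemma finite_ball x n : finite_set [set y | (dist e x y <= n)%N].
Proof.
elim: n => [|n IH].
  apply: (@sub_finite_set _ _ [set x]) => // y /=.
  by rewrite leqn0 => /eqP /(dist_eq0 econ) ->.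
apply: (@sub_finite_set _ _ ([set x] `|`
  \bigcup_(z in [set y | (dist e x y <= n)%N]) neighbors e z)).
  move=> y /=; case E : (dist e x y) => [|r] rn.
    by left; rewrite (dist_eq0 econ E).
  right; rewrite (distC esym econ) in E.
  have [z xz dz] := dist_pred esym econ (etrans (distC esym econ x y) E).
  by exists z => /=; rewrite ?dz // /neighbors /= esym.
rewrite finite_setU; split => //; apply: bigcup_finite => // z _.
exact: (graph_lf G).
Qed.

(** Markov's inequality for the truncated distance, which has mean at most t;
balls are finite. *)
Lemma hk_tight t x eps : 0 < t -> 0 < eps ->
  exists2 s, uniq s & 1 - eps <= \sum_(z <- s) hk t x z.
Proof.
move=> t0 eps0; have [N tN] : exists N : nat, t / eps <= N.+1%:R.
  have [N _] := @nbhs_infty_ger R (t / eps).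
  by move=> /(_ N (leqnn _)) /= H; exists N; rewrite (le_trans H) // ler_nat.
exists (fset_set [set y | (dist e x y <= N)%N]); first exact: fset_uniq.
set s := fset_set _; rewrite (sum_hk _ _ (fset_uniq s)).
have := heat_drift G x t0 (@trunc_dist_bounded x N.+1) (@trunc_dist_lip x N.+1).
rewrite trunc_distxx add0r => drift.
have cB : bounded_by N.+1%:R (fun _ : V => N.+1%:R : R).
  by move=> z; rewrite normr_nat.
have rB : bounded_by N.+1%:R (fun z => - N.+1%:R * restr s (fun=> 1) z).
  by move=> z; rewrite normrM normrN normr_nat ler_piMr // restr1_bounded.
have fT : T t (fun z => N.+1%:R + - N.+1%:R * restr s (fun=> 1) z) x <=
    T t (trunc_dist x N.+1) x.
  apply: (heat_le mP _ (ltW t0) (bounded_byD cB rB) (@trunc_dist_bounded x N.+1)).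
  move=> z; rewrite /restr in_fset_set; last exact: finite_ball.
  case: ifPn => [_|]; first by rewrite mulr1 subrr trunc_dist_ge0.
  rewrite notin_setE /= => /negP; rewrite -ltnNge.
  by rewrite mulr0 addr0 /trunc_dist ler_nat leq_min => ->; rewrite leqnn.
move: fT; rewrite (heatD mP _ _ cB rB) (heat_cst mP) (heatZ mP _ _ _ (@restr1_bounded s)).
move: (T t (restr _ _) x) drift => u drift fT.
have N0 : 0 < N.+1%:R :> R by rewrite ltr0n.
rewrite ler_pdivrMr // in tN; rewrite -subr_ge0.
have -> : u - (1 - eps) = (N.+1%:R * eps - (N.+1%:R + - N.+1%:R * u)) / N.+1%:R.
  by field; rewrite -[X in 1 + X]/(N%:R) nat1r gt_eqF.
by rewrite divr_ge0 ?(ltW N0) // subr_ge0 (le_trans fT) // (le_trans drift).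
Qed.

Lemma harnack_gap_ge0 t r : 0 < t -> 0 <= harnack_gap d t r.
Proof.
move=> t0; rewrite addr_ge0 //.
  by rewrite divr_ge0 ?(ltW t0) // mulr_ge0 ?sqr_ge0 //; have := quad_cst_ge18 G; lra.
by rewrite mulr_ge0 ?(log_cst_ge0 G) // ln_ge0 //; lra.
Qed.

Lemma expR1_ge2 : 2 <= expR 1 :> R.
Proof. by have := expR_ge1Dx (1 : R); lra. Qed.

(** [log_harnack] for M times the indicator of a finite set.  With M a little
larger than the cost, it turns a lower bound on the probability of the set
from x into one from y. *)
Lemma log_harnack_set t s x y M : 0 < t -> uniq s -> 0 <= M ->
  expR (M * \sum_(z <- s) hk t x z - harnack_gap d t (dist e x y)) <=
  1 + expR M * \sum_(z <- s) hk t y z.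
Proof.
move=> t0 us M0; rewrite !sum_hk //.
have MB : bounded_by M (fun z => M * restr s (fun=> 1) z).
  by move=> z; rewrite normrM ger0_norm // ler_piMr // restr1_bounded.
have := log_harnack G x y t0 MB.
rewrite (heatZ mP _ _ _ (@restr1_bounded s)) => /le_trans; apply.
have oB : bounded_by 1 (fun _ : V => 1 : R) by move=> z; rewrite normr1.
have eB : bounded_by (expR M) (fun z => expR M * restr s (fun=> 1) z).
  by move=> z; rewrite normrM ger0_norm ?expR_ge0 // ler_piMr ?expR_ge0 // restr1_bounded.
rewrite -[X in _ <= X + _](heat_cst mP t 1 y) -(heatZ mP _ _ _ (@restr1_bounded s)).
rewrite -(heatD mP _ _ oB eB).
apply: (heat_le mP _ (ltW t0) (expR_bounded MB) (bounded_byD oB eB)).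
move=> z; rewrite /restr; case: ifP => _; rewrite ?mulr1 ?mulr0 ?expR0; lra.
Qed.

(** [log_harnack_set] for the set {y}, whose probability from y is at least
exp (- t). *)
Lemma hk_lower t x y : 0 < t ->
  expR (- (expR t * (harnack_gap d t (dist e x y) + 1))) <= hk t x y.
Proof.
move=> t0; set k := harnack_gap d t _; set M := expR t * (k + 1).
have k0 : 0 <= k by exact: harnack_gap_ge0.
have M0 : 0 <= M by rewrite mulr_ge0 ?expR_ge0 //; lra.
have := @log_harnack_set t [:: y] y x M t0 isT M0; rewrite !big_seq1.
rewrite (distC esym econ) -/k => H.
have : expR 1 <= expR (M * hk t y y - k).
  rewrite ler_expR; have := ler_wpM2l M0 (hk_diag y (ltW t0)).
  by rewrite /M mulrC mulrA -expRD addNr expR0 mul1r -/M; lra.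
move=> /le_trans /(_ H) H1; have := expR1_ge2 => e2.
have : 1 <= expR M * hk t x y by lra.
by move=> H2; rewrite expRN -[leLHS]mulr1 ler_pdivrMl ?expR_gt0.
Qed.

Lemma hk_gt0 t x y : 0 < t -> 0 < hk t x y.
Proof. by move=> t0; apply: lt_le_trans (hk_lower x y t0); exact: expR_gt0. Qed.

End HeatKernel.

(** * Entropy, displacement and volume at one scale *)

Section HeatEntropy.
Variables (R : realType) (V : choiceType) (e : rel V) (d : nat).
Hypothesis G : curved_graph R e d.
Implicit Types (f g : V -> R) (x y z : V) (t s h M c F : R) (S : seq V).

Local Notation P := (@nbr_avg R V e).
Local Notation T := (heat P).
Local Notation a := (quad_cst R d).
Local Notation b := (log_cst R d).
Local Notation m x := ((deg e x)%:R).
Local Notation gap := (harnack_gap d).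
Local Notation p := (hk e).

Let mP : markov_op P := markov_nbr_avg G.
Let esym := graph_sym G.
Let econ := graph_con G.

Let finP := @nbr_avg_finite R V e.

Definition surprisal t x z : R := - ln (p t x z / m z).

(** The heat entropy is at most F. *)
Definition entropy_le t x F := forall S, uniq S ->
  \sum_(z <- S) p t x z * surprisal t x z <= F.

Lemma deg_ge1 x : 1 <= m x :> R.
Proof. by rewrite ler1n (deg_gt0 G). Qed.

Lemma surprisalE t x z : 0 < t -> surprisal t x z = ln (m z) - ln (p t x z).
Proof.
move=> t0; rewrite /surprisal ln_div ?opprB // posrE; first exact: (hk_gt0 G).
exact: (degR_gt0 G).
Qed.

Lemma surprisal_ge0 t x z : 0 < t -> 0 <= surprisal t x z.
Proof.
move=> t0; rewrite oppr_ge0 ln_le0 // ler_pdivrMr ?(degR_gt0 G) // mul1r.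
by rewrite (le_trans (hk_le1 G x z (ltW t0))) ?deg_ge1.
Qed.

Lemma entropy_le_ge0 t x F : entropy_le t x F -> 0 <= F.
Proof. by move=> /(_ [::] isT); rewrite big_nil. Qed.

Lemma entropy_leW t x F F' : F <= F' -> entropy_le t x F -> entropy_le t x F'.
Proof. by move=> FF' H S uS; exact: le_trans (H S uS) FF'. Qed.

(** Let u y be the mean of the truncated distance to x at time t from y, and mu
the mean of u at time t from x, that is the mean at time 2 t.  Concentration
from y gives a return probability at most exp (- l u y + 2 t l^2); by
reversibility the surprisal of y is at least l u y - 2 t l^2, and averaging
over y gives l mu - 2 t l^2 <= F.  The best l is mu / (4 t), an admissible
value because mu <= 2 t.  The variance bound [heat_square] then passes from
the squared mean to the second moment. *)
Lemma displacement t x F N : 0 < t -> entropy_le t x F ->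
  T (t + t) (fun z => trunc_dist R e x N z ^+ 2) x <= 8 * t * F + 2 * t.
Proof.
move=> t0 HF; set f := trunc_dist R e x N.
have tt0 : 0 < t + t by lra.
have fB : bounded_by N%:R f by exact: (trunc_dist_bounded R e x N).
have fL : lip e 1 f by exact: (trunc_dist_lip G x N).
have sq := heat_square G x tt0 fB fL.
pose u := T t f; have uB : bounded_by N%:R u by exact: (heat_bounded mP (ltW t0) fB).
have u0 z : 0 <= u z by apply: (heat_ge0 mP z (ltW t0) fB) => w; exact: trunc_dist_ge0.
set mu := T (t + t) f x in sq.
have muE : mu = T t u x by rewrite /mu -(heat_semigroup mP finP _ (ltW t0) (ltW t0) fB).
have mu0 : 0 <= mu by rewrite muE; exact: (heat_ge0 mP x (ltW t0) uB).
have mu2 : mu <= 2 * t.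
  by have := heat_drift G x tt0 fB fL; rewrite /f trunc_distxx -/f -/mu; lra.
pose l := mu / (4 * t).
have l0 : 0 <= l by rewrite divr_ge0 // mulr_ge0 // ltW.
have l2 : `|- l| <= 2^-1.
  by rewrite normrN ger0_norm // ler_pdivrMr ?mulr_gt0 //; lra.
(* The exponential moment bounds the probability of returning from y to x. *)
have ret y : p t y x <= expR (- l * u y + 2 * t * l ^+ 2).
  rewrite -(sqrrN l); apply: le_trans (heat_exp_moment G y t0 l2 fB fL).
  have lB : bounded_by (l * N%:R) (fun z => - l * f z).
    by move=> z; rewrite normrM normrN (ger0_norm l0) ler_wpM2l.
  apply: (heat_le mP y (ltW t0) (@ind_bounded R V x) (expR_bounded lB)) => z.
  rewrite /ind; case: eqP => [->|_]; last exact: expR_ge0.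
  by rewrite /f trunc_distxx mulr0 expR0.
have sur y : l * u y - 2 * t * l ^+ 2 <= surprisal t x y.
  have -> : surprisal t x y = ln (m x) - ln (p t y x).
    rewrite surprisalE //; have := congr1 (@ln R) (hk_sym G t x y).
    by rewrite [ln (m x * _)]lnM ?[ln (m y * _)]lnM ?posrE ?(hk_gt0 G) ?(degR_gt0 G) //; lra.
  have : 0 <= ln (m x) :> R by rewrite ln_ge0 // deg_ge1.
  have : ln (p t y x) <= - l * u y + 2 * t * l ^+ 2.
    by rewrite -[leRHS]expRK ler_ln ?posrE ?expR_gt0 ?(hk_gt0 G).
  lra.
(* The error eps comes from replacing T_t by a sum over a finite set. *)
have low : l * mu - 2 * t * l ^+ 2 <= F.
  apply/ler_addgt0Pr => eps eps0.
  pose eta := eps / (l * N%:R + 1).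
  have lN : 0 <= l * N%:R by rewrite mulr_ge0.
  have eta0 : 0 < eta by rewrite divr_gt0 //; lra.
  have [S uS tS] := hk_tight G x t0 eta0.
  have := HF S uS.
  have : \sum_(z <- S) p t x z * (l * u z - 2 * t * l ^+ 2) <=
      \sum_(z <- S) p t x z * surprisal t x z.
    by apply: ler_sum => z _; rewrite ler_wpM2l ?(hk_ge0 G) ?(ltW t0).
  have -> : \sum_(z <- S) p t x z * (l * u z - 2 * t * l ^+ 2) =
      l * (\sum_(z <- S) p t x z * u z) - 2 * t * l ^+ 2 * \sum_(z <- S) p t x z.
    by rewrite !mulr_sumr -sumrB; apply: eq_bigr => z _; ring.
  have s1 := sum_hk_le1 G x (ltW t0) uS.
  have : mu <= \sum_(z <- S) p t x z * u z + N%:R * eta.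
    rewrite muE -(heat_restr G t u x uS).
    have nB : bounded_by N%:R (fun _ : V => N%:R : R) by move=> z; rewrite normr_nat.
    have nsB : bounded_by N%:R (fun z => - N%:R * restr S (fun=> 1) z : R).
      by move=> z; rewrite normrM normrN normr_nat ler_piMr // restr1_bounded.
    have rB := @restr_bounded R V S u.
    have B2 := bounded_byD nB nsB.
    have := heat_le mP x (ltW t0) uB (bounded_byD rB B2) => /(_ _)/wrap[].
      move=> z; rewrite /restr; case: ifP => _; first by rewrite mulr1 subrr addr0.
      by rewrite mulr0 addr0 add0r (le_trans (ler_norm _)).
    rewrite (heatD mP _ _ rB B2) (heatD mP _ _ nB nsB) (heat_cst mP).
    rewrite (heatZ mP _ _ _ (@restr1_bounded R V S)) -(sum_hk G _ _ uS).
    move=> /le_trans; apply; rewrite lerD2l mulNr -{1}(mulr1 N%:R) -mulrBr.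
    by rewrite ler_wpM2l //; lra.
  move: (\sum_(z <- S) p t x z * u z) => A hmu.
  have hA : l * mu <= l * A + l * N%:R * eta.
    by rewrite -mulrA -mulrDr ler_wpM2l.
  have he : l * N%:R * eta <= eps.
    rewrite /eta mulrA ler_pdivrMr; last by lra.
    by rewrite mulrC ler_wpM2l ?(ltW eps0) //; lra.
  have : 2 * t * l ^+ 2 * (\sum_(z <- S) p t x z) <= 2 * t * l ^+ 2 * 1.
    by rewrite ler_wpM2l // mulr_ge0 ?sqr_ge0 // mulr_ge0 // ltW.
  by lra.
have musq : mu ^+ 2 = 8 * t * (l * mu - 2 * t * l ^+ 2).
  by rewrite /l; field; rewrite gt_eqF.
have := ler_wpM2l (ltW (mulr_gt0 (ltr0n R 8 : 0 < 8%:R) t0)) low.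
by rewrite -musq; lra.
Qed.

(** Gibbs' inequality.  The laws are compared on a finite set, where they do
not have the same mass, whence the error 1. *)
Lemma gibbs t t' x S : 0 < t -> 0 < t' -> uniq S ->
  \sum_(z <- S) p t x z * surprisal t x z <=
  \sum_(z <- S) p t x z * surprisal t' x z + 1.
Proof.
move=> t0 t'0 uS.
apply: (@le_trans _ _ (\sum_(z <- S) (p t x z * surprisal t' x z + p t' x z))).
  apply: ler_sum => z _; rewrite !surprisalE //.
  have q0 := hk_gt0 G x z t0; have q'0 := hk_gt0 G x z t'0.
  have : ln (p t' x z / p t x z) <= p t' x z / p t x z - 1.
    rewrite -[X in ln X](subrKC 1); apply: le_ln1Dx.
    by have := divr_gt0 q'0 q0; lra.
  rewrite ln_div ?posrE // => /(ler_wpM2l (ltW q0)).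
  by rewrite [X in _ <= X]mulrBr mulrCA mulfV ?gt_eqF //; lra.
by rewrite big_split /= lerD2l (sum_hk_le1 G) // ltW.
Qed.

(** [log_harnack] for phi the log-likelihood ratio of the laws at time t from
y and from x: T_t phi (y) is their relative entropy, while T_t (exp phi) (x)
is a total mass, at most 2 because phi is cut off outside the finite set. *)
Lemma cross_entropy_le t x y F S : 0 < t -> uniq S -> entropy_le t y F ->
  \sum_(z <- S) p t y z * surprisal t x z <= F + gap t (dist e x y) + 1.
Proof.
move=> t0 uS HF; pose phi z := ln (p t y z / p t x z).
have pB := @restr_bounded R V S phi.
have := log_harnack G y x t0 pB; rewrite (heat_restr G t phi y uS).
set k := gap t _ => H.
have : T t (fun z => expR (restr S phi z)) x <= 2.
  pose q z := p t y z / p t x z.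
  have oB : bounded_by 1 (fun _ : V => 1 : R) by move=> z; rewrite normr1.
  have qB := @restr_bounded R V S q.
  have := heat_le mP x (ltW t0) (expR_bounded pB) (bounded_byD oB qB).
  move=> /(_ _)/wrap[].
    move=> z; rewrite /restr; case: ifP => _; last by rewrite expR0 addr0.
    by rewrite lnK ?posrE ?divr_gt0 ?(hk_gt0 G) // lerDr.
  move=> /le_trans; apply; rewrite (heatD mP _ _ oB qB) (heat_cst mP).
  rewrite (heat_restr G t q x uS) -[2]/(1 + 1) lerD2l.
  apply: le_trans (sum_hk_le1 G y (ltW t0) uS).
  by apply: ler_sum => z _; rewrite /q mulrC divfK // gt_eqF // (hk_gt0 G).
move=> /(le_trans H) {}H.
have {}H : \sum_(z <- S) p t y z * phi z - k <= 1.
  by rewrite -ler_expR (le_trans H) // expR1_ge2.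
have := HF S uS.
have -> : \sum_(z <- S) p t y z * surprisal t x z =
   \sum_(z <- S) p t y z * surprisal t y z + \sum_(z <- S) p t y z * phi z.
  rewrite -big_split; apply: eq_bigr => z _ /=.
  by rewrite !surprisalE // /phi ln_div ?posrE ?(hk_gt0 G) //; ring.
have <- : k = gap t (dist e x y) by rewrite /k (distC esym econ).
by move: H; lra.
Qed.

(** Bound the surprisal of X_(t+s) with respect to its own law by the surprisal
with respect to the law of X_t, and condition on X_s = y: this leaves the
cross entropy of the laws at time t from y and from x. *)
Lemma entropy_step t s x F Q : 0 < t -> 0 < s ->
  (forall y, entropy_le t y F) ->
  (forall N, T s (fun z => trunc_dist R e x N z ^+ 2) x <= Q) ->
  entropy_le (t + s) x (F + 2 + a * Q / t + b * ln (1 + 2 * t)).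
Proof.
move=> t0 s0 HF HQ S uS.
have a0 : 0 < a by have := quad_cst_ge18 G; lra.
have F0 : 0 <= F := entropy_le_ge0 (HF x).
apply: le_trans (gibbs x _ t0 uS) _; first exact: addr_gt0.
pose gg := surprisal t x.
have gB := @restr_bounded R V S gg; set B := \sum_(z <- S) `|gg z| in gB.
have uE : T (t + s) (restr S gg) x = T s (T t (restr S gg)) x.
  by rewrite (heat_semigroup mP finP x (ltW s0) (ltW t0) gB) addrC.
rewrite -(heat_restr G (t + s) gg x uS) uE.
set u := T t _; have uB : bounded_by B u by exact: (heat_bounded mP (ltW t0) gB).
have B0 : 0 <= B by exact: sumr_ge0.
pose c0 := F + 1 + b * ln (1 + 2 * t).
have lb0 : 0 <= b * ln (1 + 2 * t).
  by rewrite mulr_ge0 ?(log_cst_ge0 G) // ln_ge0 //; lra.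
(* Beyond distance N the quadratic cost exceeds the crude bound B on u. *)
have [N BN] : exists N : nat, B * t / a <= N.+1%:R.
  have [N _] := @nbhs_infty_ger R (B * t / a).
  by move=> /(_ N (leqnn _)) /= H; exists N; rewrite (le_trans H) // ler_nat.
have uub z : u z <= c0 + a / t * trunc_dist R e x N.+1 z ^+ 2.
  rewrite /trunc_dist /minn; case: ltnP => dN.
    rewrite /u (heat_restr G t gg z uS).
    apply: le_trans (cross_entropy_le x t0 uS (HF z)) _.
    by rewrite /harnack_gap /c0 (mulrAC a); lra.
  apply: le_trans (_ : B <= _); first exact: le_trans (ler_norm _) (uB z).
  apply: (@le_trans _ _ (a / t * N.+1%:R)).
    by move: BN; rewrite ler_pdivrMr // mulrAC ler_pdivlMr // mulrC [a * _]mulrC.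
  rewrite -[leLHS]add0r lerD //; first by rewrite /c0; lra.
  rewrite ler_wpM2l ?divr_ge0 ?(ltW a0) ?(ltW t0) //.
  by rewrite expr2 ler_peMr // ler1n.
have fB : bounded_by (N.+1%:R ^+ 2) (fun z => trunc_dist R e x N.+1 z ^+ 2).
  by move=> z; rewrite normrX ler_pXn2r ?nnegrE ?trunc_dist_bounded.
have cB : bounded_by `|c0| (fun _ : V => c0) by move=> z.
have at0 : 0 <= a / t by rewrite divr_ge0 // ltW.
have afB : bounded_by (a / t * N.+1%:R ^+ 2)
    (fun z => a / t * trunc_dist R e x N.+1 z ^+ 2).
  by move=> z; rewrite normrM (ger0_norm at0) ler_wpM2l.
have := heat_le mP x (ltW s0) uB (bounded_byD cB afB) uub.
rewrite (heatD mP _ _ cB afB) (heat_cst mP) (heatZ mP _ _ _ fB).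
have := ler_wpM2l at0 (HQ N.+1); rewrite (mulrAC a) /c0.
by lra.
Qed.

Definition entropy_base : R := 1 + expR 1 * (2 * a + b * ln 3 + 1) + d%:R.

(** Compare with the law at time 1, which is bounded below by [hk_lower]. *)
Lemma entropy_le_base t x : 0 < t <= 1 -> entropy_le t x entropy_base.
Proof.
move=> /andP[t0 t1] S uS; have one0 : 0 < 1 :> R by [].
apply: le_trans (gibbs x t0 one0 uS) _.
have a0 : 0 < a by have := quad_cst_ge18 G; lra.
pose N := \max_(z <- S) dist e x z.
set f := trunc_dist R e x N.
have sur z : z \in S -> surprisal 1 x z <= expR 1 * (a * f z ^+ 2 + b * ln 3 + 1) + d%:R.
  move=> zS; have dN : (dist e x z <= N)%N by exact: leq_bigmax_seq.
  rewrite surprisalE // addrC lerD //.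
    rewrite lerNl -[leLHS]expRK ler_ln ?posrE ?expR_gt0 ?(hk_gt0 G) //.
    apply: le_trans (hk_lower G x z one0); rewrite ler_expR lerN2 ler_wpM2l ?expR_ge0 //.
    rewrite /harnack_gap /f /trunc_dist (minn_idPl dN) divr1 mulr1.
    by rewrite (_ : 1 + 2 = 3) //; lra.
  have m1 := deg_ge1 z.
  have : m z <= d%:R :> R by rewrite ler_nat (graph_deg G).
  by have := ln_sublinear (degR_gt0 G z); lra.
have fB : bounded_by N%:R f by exact: (trunc_dist_bounded R e x N).
have fL : lip e 1 f by exact: (trunc_dist_lip G x N).
have f2B : bounded_by (N%:R ^+ 2) (fun z => f z ^+ 2).
  by move=> z; rewrite normrX ler_pXn2r ?nnegrE.
have f2 : T t (fun z => f z ^+ 2) x <= 2.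
  have d1 := heat_drift G x t0 fB fL.
  have d2 := heat_square G x t0 fB fL.
  have d3 : 0 <= T t f x by apply: (heat_ge0 mP x (ltW t0) fB) => z; exact: trunc_dist_ge0.
  by rewrite /f trunc_distxx add0r -/f in d1; nra.
have s1 := sum_hk_le1 G x (ltW t0) uS.
have ea : 0 <= expR 1 * a by rewrite mulr_ge0 ?expR_ge0 // ltW.
pose K := expR 1 * (b * ln 3 + 1) + d%:R.
have K0 : 0 <= K.
  rewrite addr_ge0 // mulr_ge0 ?expR_ge0 // addr_ge0 // mulr_ge0 ?(log_cst_ge0 G) //.
  by rewrite ln_ge0 //; lra.
have : \sum_(z <- S) p t x z * surprisal 1 x z <=
    expR 1 * a * T t (fun z => f z ^+ 2) x + K.
  apply: (@le_trans _ _ (\sum_(z <- S) (expR 1 * a * (p t x z * f z ^+ 2) + K * p t x z))).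
    rewrite !big_seq; apply: ler_sum => z zS.
    have := ler_wpM2l (hk_ge0 G x z (ltW t0)) (sur z zS).
    by rewrite /K; lra.
  rewrite big_split /= -mulr_sumr -[X in _ + X <= _]mulr_sumr lerD //.
    rewrite ler_wpM2l //.
    have -> : \sum_(z <- S) p t x z * f z ^+ 2 =
        T t (restr S (fun z => f z ^+ 2)) x by rewrite (heat_restr G).
    apply: (heat_le mP x (ltW t0) (@restr_bounded R V S _) f2B) => z.
    by rewrite /restr; case: ifP => // _; exact: sqr_ge0.
  by rewrite ler_piMr.
have := ler_wpM2l ea f2; rewrite /K /entropy_base; lra.
Qed.

(** By Markov's inequality, the set A of points of small surprisal has
probability at least 1/2 from x; its mass is at most exp (4 F).  By
[log_harnack_set] the walk from any y in B hits A with probability at least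
exp (- M), and by reversibility the sum of these probabilities weighted by
the degrees is at most the mass of A. *)
Lemma volume_le t x F r B : 0 < t -> 0 < F -> entropy_le t x F -> uniq B ->
  (forall y, y \in B -> (dist e x y <= r)%N) ->
  \sum_(y <- B) m y <= expR (4 * F + 2 * gap t r + 2).
Proof.
move=> t0 F0 HF uB Br.
have q4 : 0 < 4^-1 :> R by rewrite invr_gt0.
have [S uS tS] := hk_tight G x t0 q4.
pose A := [seq z <- S | surprisal t x z <= 4 * F].
have uA : uniq A by exact: filter_uniq.
have pA : 2^-1 <= \sum_(z <- A) p t x z.
  rewrite big_filter.
  have : 4 * F * \sum_(z <- S | ~~ (surprisal t x z <= 4 * F)) p t x z <= F.
    apply: le_trans (HF S uS).
    rewrite mulr_sumr [leRHS](bigID (fun z => surprisal t x z <= 4 * F)) /=.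
    rewrite -[leLHS]add0r lerD ?sumr_ge0 // => [z _|].
      by rewrite mulr_ge0 ?surprisal_ge0 ?(hk_ge0 G) ?(ltW t0).
    apply: ler_sum => z; rewrite -ltNge => /ltW H.
    by rewrite [leLHS]mulrC ler_wpM2l ?(hk_ge0 G) ?(ltW t0).
  move: tS; rewrite (bigID (fun z => surprisal t x z <= 4 * F)) /=.
  move: (\sum_(z <- S | _) _) (\sum_(z <- S | _) _) => u v tS H.
  have : u <= 4^-1 by rewrite -(ler_pM2l F0); lra.
  by lra.
have mA : \sum_(z <- A) m z <= expR (4 * F).
  have : \sum_(z <- A) m z <= \sum_(z <- A) expR (4 * F) * p t x z.
    rewrite !big_filter; apply: ler_sum => z.
    rewrite /surprisal lerNl -[X in X <= _]expRK.
    rewrite ler_ln ?posrE ?expR_gt0 ?divr_gt0 ?(hk_gt0 G) ?(degR_gt0 G) //.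
    rewrite ler_pdivlMr ?(degR_gt0 G) // expRN => H.
    by rewrite -ler_pdivrMl ?expR_gt0.
  move=> /le_trans; apply; rewrite -mulr_sumr ler_piMr ?expR_ge0 //.
  exact: (sum_hk_le1 G x (ltW t0) uA).
pose k := gap t r; have k0 : 0 <= k by exact: (harnack_gap_ge0 G).
pose M := 2 * k + 2; have M0 : 0 <= M by rewrite /M; lra.
have low y : y \in B -> expR (- M) <= \sum_(z <- A) p t y z.
  move=> yB; have := log_harnack_set G x y t0 uA M0.
  have gk : gap t (dist e x y) <= k.
    rewrite /k /harnack_gap lerD2r ler_wpM2r ?invr_ge0 ?(ltW t0) //.
    rewrite ler_wpM2l //; first by have := quad_cst_ge18 G; lra.
    by rewrite ler_pXn2r ?nnegrE // ler_nat Br.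
  have : expR 1 <= expR (M * \sum_(z <- A) p t x z - gap t (dist e x y)).
    by rewrite ler_expR; have := ler_wpM2l M0 pA; rewrite /M; lra.
  move=> /le_trans H1 /H1 H2; have := expR1_ge2 R => e2.
  have H3 : 1 <= expR M * \sum_(z <- A) p t y z by lra.
  by rewrite expRN -[leLHS]mulr1 ler_pdivrMl ?expR_gt0.
have : expR (- M) * \sum_(y <- B) m y <= expR (4 * F).
  apply: le_trans mA; rewrite mulr_sumr.
  apply: (@le_trans _ _ (\sum_(y <- B) \sum_(z <- A) m z * p t z y)).
    rewrite !big_seq; apply: ler_sum => y yB.
    under eq_bigr do rewrite -(hk_sym G t y).
    by rewrite -mulr_sumr mulrC ler_wpM2l // low.
  rewrite exchange_big /=; apply: ler_sum => z _.
  rewrite -mulr_sumr ler_piMr //; exact: (sum_hk_le1 G z (ltW t0) uB).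
rewrite expRN ler_pdivrMl ?expR_gt0 // => /le_trans; apply.
by rewrite -expRD ler_expR /M -/k; lra.
Qed.

End HeatEntropy.

(** * Multiscale iteration *)

Section Multiscale.
Variables (R : realType) (V : choiceType) (e : rel V) (d : nat).
Hypothesis G : curved_graph R e d.
Implicit Types (x y z : V) (t s u F L : R).

Local Notation a := (quad_cst R d).
Local Notation b := (log_cst R d).

Definition entropy_all t F := forall x, @entropy_le R V e t x F.

Lemma displacement_half s x F N : 0 < s -> entropy_le e (s / 2) x F ->
  heat (@nbr_avg R V e) s (fun z => trunc_dist R e x N z ^+ 2) x <= 4 * s * F + s.
Proof.
move=> s0 HF; have s20 : 0 < s / 2 by rewrite divr_gt0.
have := displacement G N s20 HF.
rewrite -(mulr2n (s / 2)) -(mulr_natr (s / 2)) divfK ?pnatr_eq0 //.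
by lra.
Qed.

Lemma entropy_all_step t s F1 F : 0 < t -> 0 < s ->
  entropy_all t F1 -> entropy_all (s / 2) F ->
  entropy_all (t + s) (F1 + 2 + a * (4 * s * F + s) / t + b * ln (1 + 2 * t)).
Proof.
move=> t0 s0 H1 H x; apply: (entropy_step G t0 s0 H1) => N.
exact: displacement_half.
Qed.

Lemma a_gt0 : 0 < a. Proof. by have := quad_cst_ge18 G; lra. Qed.

Definition scale_factor T : R := 3 + (b + 10 * a) * ln (1 + 2 * T).

(** Go from time h <= s to time u = N h by N - 1 <= F steps of length h.  The
step from j h to (j + 1) h adds 2 + a (4 F + 1) / j + b ln (1 + 2 T): the
displacement during one step is controlled by the hypothesis, and its effect
is divided by j h.  The harmonic sum is compared with the logarithm. *)
Lemma entropy_scale T s F : 1 <= s -> 1 <= F ->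
  (forall u, 0 < u <= s -> entropy_all u F) ->
  forall u, 0 < u <= s * F -> u <= T -> entropy_all u (F * scale_factor T).
Proof.
move=> s1 F1 H u /andP[u0 usF] uT.
have a0 := a_gt0; have b0 := log_cst_ge0 G.
set Lam := ln (1 + 2 * T).
have Lam0 : 0 <= Lam by rewrite ln_ge0 //; lra.
have Lam' : 0 <= (b + 10 * a) * Lam by rewrite mulr_ge0 //; lra.
have [us|su] := leP u s.
  move=> x; apply: entropy_leW (H u _ x); last by rewrite u0.
  by rewrite ler_peMr /scale_factor -/Lam; lra.
have s0 : 0 < s by lra.
pose N := (Num.truncn (u / s)).+1.
have us0 : 0 <= u / s by rewrite divr_ge0 // ltW.
have /andP[N1 N2] := Num.Theory.truncn_itv us0.
have N0 : 0 < N%:R :> R by rewrite ltr0n.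
pose h := u / N%:R; have h0 : 0 < h by rewrite divr_gt0.
have hs : h <= s by rewrite /h ler_pdivrMr // mulrC -ler_pdivrMr // ltW.
have hN : N%:R * h = u by rewrite /h mulrC divfK // gt_eqF.
(* 2 ln (j + 1) bounds the harmonic sum up to j. *)
have main j : (j < N)%N -> entropy_all (j.+1%:R * h)
    (F + j%:R * (2 + b * Lam) + 2 * (a * (4 * F + 1)) * ln j.+1%:R).
  elim: j => [|j IH] jN.
    by rewrite ln1 mulr0 mul0r !addr0 mul1r; apply: H; rewrite h0.
  have jh0 : 0 < j.+1%:R * h by rewrite mulr_gt0 // ltr0n.
  have h2 : entropy_all (h / 2) F.
    by apply: H; rewrite divr_gt0 //=; lra.
  have := entropy_all_step jh0 h0 (IH (ltnW jN)) h2.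
  have -> : j.+1%:R * h + h = j.+2%:R * h by rewrite -(natr1 j.+1) mulrDl mul1r.
  move=> st x; apply: entropy_leW (st x).
  have j0 : 0 < j.+1%:R :> R by rewrite ltr0n.
  have j20 : 0 < j.+2%:R :> R by rewrite ltr0n.
  have e1 : a * (4 * h * F + h) / (j.+1%:R * h) = a * (4 * F + 1) * j.+1%:R^-1.
    by move: (j.+1%:R) j0 => w w0; field; rewrite !gt_eqF.
  have e2 : j.+1%:R^-1 <= 2 * (ln j.+2%:R - ln j.+1%:R) :> R.
    have : ln (j.+1%:R / j.+2%:R) <= - j.+2%:R^-1 :> R.
      have -> : j.+1%:R / j.+2%:R = 1 + - j.+2%:R^-1 :> R.
        rewrite (_ : j.+2%:R = j.+1%:R + 1); last by rewrite natr1.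
        by move: (j.+1%:R) j0 => w w0; field; rewrite gt_eqF //; lra.
      apply: le_ln1Dx; rewrite ltrN2 invf_lt1 // ltr1n //.
    rewrite ln_div ?posrE // => H1.
    have H2 : j.+1%:R^-1 <= 2 * j.+2%:R^-1 :> R.
      rewrite -[leLHS]mul1r ler_pdivrMr // mulrAC ler_pdivlMr // mul1r.
      by rewrite -natrM ler_nat mul2n -addnn addSn ltnS leq_addl.
    move: H1 H2; move: (ln j.+1%:R) (ln j.+2%:R) (j.+1%:R^-1) (j.+2%:R^-1).
    by move=> *; lra.
  have e3 : ln (1 + 2 * (j.+1%:R * h)) <= Lam.
    have : j.+1%:R * h <= u by rewrite -hN ler_wpM2r ?(ltW h0) // ler_nat ltnW.
    by rewrite /Lam => ?; rewrite ler_ln ?posrE; lra.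
  rewrite e1 (_ : j.+1%:R * (2 + b * Lam) = j%:R * (2 + b * Lam) + (2 + b * Lam));
    last by rewrite -natr1 mulrDl mul1r.
  have := ler_wpM2l b0 e3.
  have c0 : 0 <= a * (4 * F + 1) by rewrite mulr_ge0 //; lra.
  have := ler_wpM2l c0 e2.
  by move: (ln j.+2%:R) (ln j.+1%:R) (j.+1%:R^-1) (j%:R) => *; lra.
have := main N.-1 (ltnSn _); rewrite prednK // hN => mN x.
apply: entropy_leW (mN x).
have NF : N.-1%:R <= F.
  by rewrite (le_trans N1) // ler_pdivrMr // mulrC.
have lnN : ln N%:R <= Lam.
  rewrite ler_ln ?posrE //; last by lra.
  have : u / s <= T.
    by rewrite ler_pdivrMr // (le_trans uT) // ler_peMr //; lra.
  by rewrite -(natr1 (Num.truncn (u / s))); lra.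
have q1 : N.-1%:R * (2 + b * Lam) <= F * (2 + b * Lam).
  by rewrite ler_wpM2r // addr_ge0 // mulr_ge0.
have q2 : 2 * (a * (4 * F + 1)) * ln N%:R <= 2 * (a * (5 * F)) * Lam.
  apply: ler_pM => //; first by rewrite mulr_ge0 // mulr_ge0; lra.
    by rewrite ln_ge0 // ler1n.
  by rewrite ler_pM2l // ler_pM2l //; lra.
rewrite /scale_factor -/Lam; move: q1 q2; lra.
Qed.

Fixpoint tri n : nat := if n is n'.+1 then tri n' + n else 0.

Lemma tri2 n : (tri n * 2 = n * n.+1)%N.
Proof. by elim: n => //= n IH; lia. Qed.

(** Adding the entropy at time 1 makes the induction of [entropy_iterate] start
at exponent 1. *)
Definition iteration_factor T : R := scale_factor T + entropy_base R d.

Lemma entropy_base_ge1 : 1 <= entropy_base R d.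
Proof.
have a0 := a_gt0; have b0 := log_cst_ge0 G.
rewrite /entropy_base -addrA lerDl addr_ge0 // mulr_ge0 ?expR_ge0 //.
have : 0 <= b * ln 3 by rewrite mulr_ge0 // ln_ge0 //; lra.
by lra.
Qed.

(** Each round multiplies the entropy by the factor and the time by the entropy
reached so far, whence triangular exponents for the time. *)
Lemma entropy_iterate T i : 1 <= T -> forall u, 0 < u <= iteration_factor T ^+ tri i ->
  u <= T -> entropy_all u (iteration_factor T ^+ i.+1).
Proof.
move=> T1; set L := iteration_factor T.
have a0 := a_gt0; have b0 := log_cst_ge0 G; have eb := entropy_base_ge1.
have sf : 3 <= scale_factor T.
  by rewrite lerDl mulr_ge0 ?ln_ge0 //; lra.
have LE : L = scale_factor T + entropy_base R d by [].
have L1 : 1 <= L by lra.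
elim: i => [|i IH] u.
  rewrite expr0 expr1 => u1 uT x; apply: entropy_leW (entropy_le_base G x u1).
  by lra.
move=> /andP[u0 uL] uT.
have [LT|TL] := leP (L ^+ tri i) T; last first.
  move=> x; apply: entropy_leW (IH u _ uT x); first by rewrite ler_weXn2l.
  by rewrite u0 (le_trans uT) // ltW.
have H v : 0 < v <= L ^+ tri i -> entropy_all v (L ^+ i.+1).
  by move=> vL; apply: IH => //; case/andP: vL => _ /le_trans; apply.
have := @entropy_scale T (L ^+ tri i) (L ^+ i.+1) _ _ H u _ uT.
move=> /(_ _ _ _)/wrap[]; rewrite ?exprn_ege1 // -?exprD ?u0 //.
move=> E x; apply: entropy_leW (E x); rewrite [leRHS]exprSr ler_wpM2l ?exprn_ge0 //; lra.
Qed.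

End Multiscale.

(** * Growth bounds *)

Section Growth.
Variables (R : realType) (V : choiceType) (e : rel V) (d : nat).
Hypothesis G : curved_graph R e d.
Implicit Types (x y z : V) (t s u F L T : R).

Local Notation a := (quad_cst R d).
Local Notation b := (log_cst R d).

Definition loglog T : R := Num.sqrt (ln T * ln (ln T)).

Lemma loglog_facts T : expR (expR 1) <= T ->
  [/\ 1 <= ln (ln T), ln (ln T) <= loglog T, ln (ln T) <= ln T &
      loglog T ^+ 2 = ln T * ln (ln T)].
Proof.
move=> hT; have T0 : 0 < T := lt_le_trans (expR_gt0 _) hT.
have l1 : expR 1 <= ln T by rewrite -[leLHS]expRK ler_ln ?posrE ?expR_gt0.
have l0 : 0 < ln T := lt_le_trans (expR_gt0 _) l1.
have ll1 : 1 <= ln (ln T) by rewrite -[leLHS]expRK ler_ln ?posrE ?expR_gt0.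
have ll2 : ln (ln T) <= ln T by exact/ltW/ln_sublinear.
have p0 : 0 <= ln T * ln (ln T) by rewrite mulr_ge0 ?(ltW l0) //; lra.
split => //; last by rewrite sqr_sqrtr.
have ll0 : 0 <= ln (ln T) by lra.
by rewrite -[leLHS](ger0_norm ll0) -sqrtr_sqr ler_wsqrtr // expr2 ler_wpM2r.
Qed.

Definition factor_cst : R := 3 + entropy_base R d + 3 * (b + 10 * a).

Definition entropy_cst : R := 4 * (ln factor_cst + 1).

Lemma factor_cst_ge4 : 4 <= factor_cst.
Proof.
have a0 := a_gt0 G; have b0 := log_cst_ge0 G; have eb := entropy_base_ge1 G.
by rewrite /factor_cst; lra.
Qed.

Lemma iteration_factor_le T : expR (expR 1) <= T ->
  iteration_factor d T <= factor_cst * ln T.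
Proof.
move=> hT; have [ll1 _ ll2 _] := loglog_facts hT.
have a0 := a_gt0 G; have b0 := log_cst_ge0 G; have eb := entropy_base_ge1 G.
have T1 : 1 <= T.
  have := expR_ge1Dx (expR 1 : R); have := expR_gt0 (1 : R); lra.
have T0 : 0 < T by lra.
have L3 : ln (1 + 2 * T) <= 3 * ln T.
  have : ln (1 + 2 * T) <= ln (3 * T) by rewrite ler_ln ?posrE; lra.
  have : ln (3 * T) <= 2 + ln T.
    rewrite lnM ?posrE // lerD2r.
    by have := @le_ln1Dx R 2; rewrite (_ : 1 + 2 = 3); [apply; lra|lra].
  by lra.
rewrite /iteration_factor /scale_factor /factor_cst.
have ba : 0 <= b + 10 * a by lra.
have := ler_wpM2l ba L3.
have : entropy_base R d <= entropy_base R d * ln T by rewrite ler_peMr; lra.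
have l1 : 1 <= ln T by lra.
move: l1; move: (ln T) (ln (1 + 2 * T)) (b + 10 * a) (entropy_base R d).
by move=> *; lra.
Qed.

(** Let k = ln L.  Time T is reached after i rounds as soon as
i (i + 1) k / 2 >= ln T, hence for i just above q = sqrt (2 ln T / k); the
entropy is then at most exp ((q + 2) k), and k = O(ln (ln T)). *)
Lemma entropy_growth T u : expR (expR 1) <= T -> 0 < u <= T ->
  entropy_all e u (growth_bound entropy_cst T).
Proof.
move=> hT /andP[u0 uT]; have [ll1 llS ll2 S2] := loglog_facts hT.
have a0 := a_gt0 G; have b0 := log_cst_ge0 G; have eb := entropy_base_ge1 G.
have T1 : 1 <= T.
  have := expR_ge1Dx (expR 1 : R); have := expR_gt0 (1 : R); lra.
have T0 : 0 < T by lra.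
set L := iteration_factor d T; pose k := ln L.
have L4 : 4 <= L.
  rewrite /L /iteration_factor /scale_factor.
  have : 0 <= (b + 10 * a) * ln (1 + 2 * T).
    by rewrite mulr_ge0 ?ln_ge0 //; lra.
  by lra.
have L0 : 0 < L by lra.
have k0 : 0 < k by rewrite ln_gt0 //; lra.
have f4 := factor_cst_ge4.
pose c := ln factor_cst + 1.
have c1 : 1 <= c by rewrite /c lerDr ln_ge0 //; lra.
have kc : k <= c * ln (ln T).
  apply: (@le_trans _ _ (ln factor_cst + ln (ln T))).
    rewrite -lnM ?posrE; [|lra|lra].
    by rewrite ler_ln ?posrE ?mulr_gt0 ?iteration_factor_le //; lra.
  have : 0 <= ln factor_cst by rewrite ln_ge0 //; lra.
  by rewrite /c => ?; nra.
have [q q0 q2] : exists2 q, 0 <= q & q ^+ 2 = 2 * ln T / k.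
  exists (Num.sqrt (2 * ln T / k)); first exact: sqrtr_ge0.
  by rewrite sqr_sqrtr // divr_ge0 ?(ltW k0) // mulr_ge0 //; lra.
have cE : entropy_cst = 4 * c by [].
move: c cE c1 kc => c cE c1 kc.
pose i := (Num.truncn q).+1.
have /andP[i1 i2] := Num.Theory.truncn_itv q0.
have TL : T <= L ^+ tri i.
  have -> : L ^+ tri i = expR ((tri i)%:R * k).
    by rewrite expRM_natl /k lnK ?posrE.
  rewrite -[leLHS]lnK ?posrE // ler_expR.
  have : (tri i)%:R * 2 = i%:R * i.+1%:R :> R by rewrite -!natrM tri2.
  have ii : i%:R <= i.+1%:R :> R by rewrite ler_nat.
  have : q ^+ 2 * k <= i%:R * i.+1%:R * k.
    rewrite ler_wpM2r ?(ltW k0) // expr2; apply: ler_pM => //; first exact: ltW.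
    exact: le_trans (ltW i2) ii.
  by rewrite q2 divfK ?gt_eqF // => A B; move: A; rewrite -B; lra.
have uL : 0 < u <= L ^+ tri i by rewrite u0 (le_trans uT).
move=> x; apply: entropy_leW (entropy_iterate G T1 uL uT x).
rewrite -/L /growth_bound -/(loglog T).
have -> : L ^+ i.+1 = expR (i.+1%:R * k) by rewrite expRM_natl /k lnK ?posrE.
rewrite ler_expR.
have iq : i.+1%:R <= q + 2.
  have -> : i.+1%:R = (Num.truncn q)%:R + 2 :> R by rewrite -natrD addn2.
  by rewrite lerD2r.
have qk : q * k <= 2 * c * loglog T.
  have S0 : 0 <= loglog T by exact: sqrtr_ge0.
  have n1 : 0 <= q * k by rewrite mulr_ge0 // ltW.
  have n2 : 0 <= 2 * c * loglog T by rewrite mulr_ge0 // mulr_ge0 //; lra.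
  suff : (q * k) ^+ 2 <= (2 * c * loglog T) ^+ 2.
    by rewrite ler_sqr // nnegrE.
  have -> : (q * k) ^+ 2 = 2 * ln T * k.
    by rewrite exprMn q2; field; rewrite gt_eqF.
  have -> : (2 * c * loglog T) ^+ 2 = 4 * (c ^+ 2 * (ln T * ln (ln T))).
    by rewrite exprMn S2 exprMn; ring.
  have l0 : 0 <= 2 * ln T by lra.
  have p0 : 0 <= ln T * ln (ln T) by rewrite mulr_ge0; lra.
  have A1 := ler_wpM2l l0 kc.
  have A2 : c * (ln T * ln (ln T)) <= c ^+ 2 * (ln T * ln (ln T)).
    by rewrite ler_wpM2r // expr2 ler_peMl //; lra.
  have A3 : 0 <= c ^+ 2 * (ln T * ln (ln T)) by rewrite mulr_ge0 ?sqr_ge0.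
  move: A1 A2 A3; move: (ln T) (ln (ln T)) (c ^+ 2) => l ll c2.
  by move=> *; lra.
have := ler_wpM2r (ltW k0) iq.
have : c * ln (ln T) <= c * loglog T by rewrite ler_wpM2l //; lra.
by rewrite cE; lra.
Qed.

Lemma growth_bound_le C C' T : C <= C' -> growth_bound C T <= growth_bound C' T.
Proof. by move=> CC; rewrite ler_expR ler_wpM2r // sqrtr_ge0. Qed.

(** K <= exp K, and the square root is at least 1 in this range. *)
Lemma growth_bound_absorb C K T : expR (expR 1) <= T -> 0 <= K ->
  K * growth_bound C T <= growth_bound (C + K) T.
Proof.
move=> hT K0; have [ll1 llS _ _] := loglog_facts hT.
rewrite /growth_bound mulrDl expRD mulrC ler_wpM2l ?expR_ge0 //.
apply: (@le_trans _ _ (expR K)); first by have := expR_ge1Dx K; lra.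
by rewrite ler_expR ler_peMr // -/(loglog T); lra.
Qed.

Lemma displacement_growth T x N : expR (expR 1) <= T ->
  heat (@nbr_avg R V e) T (fun z => trunc_dist R e x N z ^+ 2) x <=
  T * growth_bound (entropy_cst + 5) T.
Proof.
move=> hT; have T0 : 0 < T := lt_le_trans (expR_gt0 _) hT.
have T2 : 0 < T / 2 <= T by rewrite divr_gt0 //=; lra.
have HF := entropy_growth hT T2 x.
have := displacement_half G N T0 HF.
have F1 : 1 <= growth_bound entropy_cst T.
  rewrite -[leLHS]expR0 ler_expR mulr_ge0 ?sqrtr_ge0 //.
  rewrite mulr_ge0 // addr_ge0 // ln_ge0 //; have := factor_cst_ge4; lra.
have : T * (5 * growth_bound entropy_cst T) <= T * growth_bound (entropy_cst + 5) T.
  by rewrite ler_pM2l // growth_bound_absorb.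
nra.
Qed.

Definition volume_cst : R := 2 * entropy_cst + 1 + (6 + 2 * a + 8 * b).

(** [volume_le] at time r^2, for which r^2 / t is bounded and all logarithms
are comparable with those of r. *)
Lemma volume_growth r x B : expR (expR 1) <= r -> uniq B ->
  (forall y, y \in B -> (dist e x y)%:R <= r) ->
  \sum_(y <- B) (deg e y)%:R <= expR (growth_bound volume_cst r).
Proof.
move=> hr uB Br; have [ll1 llS ll2 S2] := loglog_facts hr.
have a0 := a_gt0 G; have b0 := log_cst_ge0 G.
have r1 : 1 <= r.
  have := expR_ge1Dx (expR 1 : R); have := expR_gt0 (1 : R); lra.
have r0 : 0 < r by lra.
have r2 : 1 <= r ^+ 2 by rewrite exprn_ege1.
have r20 : 0 < r ^+ 2 by lra.
have rr2 : r <= r ^+ 2 by rewrite expr2 ler_peMl // ltW.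
have hr2 : expR (expR 1) <= r ^+ 2 by exact: le_trans hr rr2.
have C0 : 0 <= entropy_cst.
  by rewrite mulr_ge0 // addr_ge0 // ln_ge0 //; have := factor_cst_ge4; lra.
have HF : entropy_all e (r ^+ 2) (growth_bound entropy_cst (r ^+ 2)).
  by apply: entropy_growth; rewrite // r20 lexx.
set F := growth_bound _ _ in HF.
have F0 : 0 < F by exact: expR_gt0.
have Bn y : y \in B -> (dist e x y <= Num.truncn r)%N.
  by move=> /Br; rewrite truncn_ge_nat // ltW.
apply: le_trans (volume_le G r20 F0 (HF x) uB Bn) _; rewrite ler_expR.
have lr2 : ln (r ^+ 2) = 2 * ln r by rewrite lnXn // mulr_natl.
have FS : F <= growth_bound (2 * entropy_cst) r.
  rewrite /F /growth_bound ler_expR [2 * entropy_cst]mulrC -[leRHS]mulrA.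
  rewrite ler_wpM2l //.
  have : ln (ln (r ^+ 2)) <= 2 * ln (ln r).
    rewrite lr2 lnM ?posrE //; last by lra.
    have : ln 2 <= 1 :> R by have := @le_ln1Dx R 1; rewrite (_ : 1 + 1 = 2) //; apply; lra.
    by lra.
  rewrite lr2 => l2; have S0 : 0 <= 2 * Num.sqrt (ln r * ln (ln r)) by rewrite mulr_ge0 ?sqrtr_ge0.
  rewrite -[leRHS](ger0_norm S0) -sqrtr_sqr ler_wsqrtr // exprMn -/(loglog r) S2.
  have l0 : 0 <= 2 * ln r by lra.
  by have := ler_wpM2l l0 l2; lra.
have gapb : harnack_gap d (r ^+ 2) (Num.truncn r) <= a + 4 * b * ln r.
  rewrite /harnack_gap lerD //.
    rewrite ler_pdivrMr // ler_wpM2l ?(ltW a0) // ler_pXn2r ?nnegrE ?(ltW r0) //.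
    by rewrite truncn_le ltW.
  apply: (@le_trans _ _ (b * (4 * ln r))); last by lra.
  rewrite ler_wpM2l //.
  have : ln (1 + 2 * r ^+ 2) <= ln (3 * r ^+ 2) by rewrite ler_ln ?posrE; lra.
  rewrite lnM ?posrE // lr2.
  have : ln 3 <= 2 :> R by have := @le_ln1Dx R 2; rewrite (_ : 1 + 2 = 3); [apply; lra|lra].
  by lra.
have lS : ln r <= growth_bound 1 r.
  rewrite -[leLHS]lnK ?posrE; last by lra.
  by rewrite /growth_bound mul1r ler_expR.
pose E := growth_bound (2 * entropy_cst + 1) r.
have E1 : growth_bound 1 r <= E by apply: growth_bound_le; lra.
have E2 : growth_bound (2 * entropy_cst) r <= E by apply: growth_bound_le; lra.
have E0 : 1 <= growth_bound 1 r by lra.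
have E3 : (6 + 2 * a + 8 * b) * E <= growth_bound volume_cst r.
  by apply: growth_bound_absorb => //; lra.
have EE : 1 <= E by lra.
have := ler_wpM2l b0 (le_trans lS E1).
have : a <= a * E by rewrite ler_peMr // ltW.
lra.
Qed.

(** Balls are finite, so the one-dimensional marginal at time t determines the
integral of the squared distance over {X_t in ball}; let the radius grow and
use monotone convergence. *)
Lemma expectation_sqdist_le x t Q (dO : measure_display) (O : measurableType dO)
    (Pr : probability O R) (X : R -> O -> V) : 0 <= t ->
  random_walk_from e x Pr X ->
  (forall N, heat (@nbr_avg R V e) t (fun z => trunc_dist R e x N z ^+ 2) x <= Q) ->
  ('E_Pr[(fun w => ((dist e x (X t w))%:R ^+ 2)%R)] <= Q%:E)%E.
Proof.
move=> t0 [mX fdd] HQ; rewrite unlock.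
have mphi (phi : V -> R) : measurable_fun [set: O] (EFin \o (fun w => phi (X t w))).
  apply/measurable_EFinP => _ B mB; rewrite setTI.
  exact: (mX t (phi @^-1` B) t0).
pose ball N : {fset V} := fset_set [set y | (dist e x y <= N)%N].
pose sq y : R := (dist e x y)%:R ^+ 2.
have in_ball N y : (y \in ball N) = (dist e x y <= N)%N.
  rewrite in_fset_set; last exact: (finite_ball G).
  by apply/idP/idP => [/set_mem|H] //; exact: mem_set.
pose g N w : \bar R := (restr (ball N) sq (X t w))%:E.
have law y : Pr (X t @^-1` [set y]) = (hk e t x y)%:E.
  have := fdd [:: (t, y)]; rewrite /= t0 => /(_ isT).
  rewrite subr0 mulr1 (heat_kernelE G) => <-; congr (Pr _).
  by apply/seteqP; split => w /=; rewrite andbT => /eqP.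
have intg N : (\int[Pr]_w g N w <= Q%:E)%E.
  have -> : (\int[Pr]_w g N w =
      \int[Pr]_w (\sum_(y <- ball N) ((sq y)%:E * (\1_(X t @^-1` [set y]) w)%:E)))%E.
    apply: eq_integral => w _; rewrite /g /restr; case: ifPn => [inb|ninb].
      rewrite (big_fsetD1 (X t w)) //= indicE mem_set // mule1 big_seq big1 ?adde0 // => y.
      rewrite in_fsetD1 => /andP[yX _]; rewrite indicE memNset ?mule0 //= => Xy.
      by rewrite Xy eqxx in yX.
    rewrite big_seq big1 // => y yb; rewrite indicE memNset ?mule0 //= => Xy.
    by rewrite Xy yb in ninb.
  have mE y : measurable (X t @^-1` [set y]) by exact: mX.
  rewrite ge0_integral_sum //; last 2 first.
  - by move=> y; apply: measurable_funeM; apply/measurable_EFinP; exact: measurable_indic.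
  - by move=> y w _; rewrite mule_ge0 // lee_fin ?sqr_ge0.
  have termE y : (\int[Pr]_w ((sq y)%:E * (\1_(X t @^-1` [set y]) w)%:E) =
      (hk e t x y * sq y)%:E)%E.
    rewrite ge0_integralZl_EFin ?sqr_ge0 //; last first.
      by apply/measurable_EFinP; exact: measurable_indic.
    rewrite integral_indic; [|exact: measurableT|exact: mE].
    rewrite setIT; transitivity ((sq y)%:E * (hk e t x y)%:E)%E.
      by congr (_ * _)%E; exact: law.
    by rewrite -EFinM mulrC.
  rewrite (eq_bigr _ (fun y _ => termE y)).
  rewrite sumEFin lee_fin -(heat_restr G t sq x (fset_uniq _)).
  have fB : bounded_by (N%:R ^+ 2) (fun z => trunc_dist R e x N z ^+ 2).
    by move=> z; rewrite normrX ler_pXn2r ?nnegrE ?trunc_dist_bounded.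
  apply: le_trans (HQ N).
  apply: (heat_le (markov_nbr_avg G) x t0 (@restr_bounded R V _ _) fB).
  move=> z; rewrite /restr in_ball; case: ifP => [dN|_]; last exact: sqr_ge0.
  by rewrite /trunc_dist (minn_idPl dN).
have glim w : limn (g ^~ w) = (sq (X t w))%:E.
  apply/cvg_lim => //; apply: cvg_near_cst; exists (dist e x (X t w)) => // N /= dN.
  by rewrite /g /restr in_ball dN.
have gnd w : {homo g ^~ w : m n / (m <= n)%N >-> (m <= n)%E}.
  move=> m n mn; rewrite lee_fin /restr !in_ball.
  case: ifP => [dm|_]; first by rewrite (leq_trans dm mn).
  by case: ifP => // _; exact: sqr_ge0.
have g0 n w : [set: O] w -> (0 <= g n w)%E.
  by move=> _; rewrite lee_fin /restr; case: ifP => // _; exact: sqr_ge0.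
have mg n : measurable_fun [set: O] (g n) by exact: mphi.
rewrite (eq_integral (fun w => limn (g ^~ w))); last by move=> w _; rewrite glim.
rewrite monotone_convergence //.
apply: lime_le; last exact: nearW.
apply: ereal_nondecreasing_is_cvgn => m n mn; apply: ge0_le_integral => //.
- exact: g0.
- by move=> w _; exact: gnd.
Qed.

End Growth.

Theorem theorem2p1 (R : realType) (d : nat) :
  exists C : R,
  forall (V : choiceType) (e : rel V),
    symmetric e -> irreflexive e ->
    locally_finite_graph e ->
    connected_graph e ->
    (exists x y, e x y) ->
    (forall x, (deg e x <= d)%N) ->
    nonneg_ollivier_ricci R e ->
  forall (x : V) (r t : R), expR (expR 1) <= r -> expR (expR 1) <= t ->
    [/\ forall (dO : measure_display) (O : measurableType dO)
               (Pr : probability O R) (X : R -> O -> V),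
          random_walk_from e x Pr X ->
          ('E_Pr[(fun w => ((dist e x (X t w))%:R ^+ 2)%R)]
            <= (t * growth_bound C t)%:E)%E,
        (heat_entropy e t x <= (growth_bound C t)%:E)%E &
        (lne (vol R e (gball e x r)) <= (growth_bound C r)%:E)%E].
Proof.
pose C1 := Num.max (entropy_cst R d + 5) (volume_cst R d).
exists C1 => V e esym eirr elf econ eedge edeg ecurv x r t hr ht.
have G : curved_graph R e d by split.
have t0 : 0 < t := lt_le_trans (expR_gt0 _) ht.
have leC1 : entropy_cst R d + 5 <= C1 by rewrite le_max lexx.
have leC2 : volume_cst R d <= C1 by rewrite le_max lexx orbT.
split.
- move=> dO O Pr X rwX; apply: (expectation_sqdist_le G (ltW t0) rwX) => N.
  apply: le_trans (displacement_growth G x N ht) _.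
  by rewrite ler_wpM2l ?(ltW t0) // growth_bound_le.
- apply: esum_le_seq => S uS _; rewrite lee_fin.
  have tt : 0 < t <= t by rewrite t0 lexx.
  have := entropy_growth G ht tt x uS.
  under eq_bigr do rewrite /surprisal mulrN -!(heat_kernelE G).
  move=> /le_trans; apply; apply: growth_bound_le.
  by apply: le_trans leC1; rewrite lerDl.
- have vle : (vol R e (gball e x r) <= (expR (growth_bound C1 r))%:E)%E.
    apply: esum_le_seq => B uB Br; rewrite lee_fin.
    apply: le_trans (volume_growth G hr uB Br) _.
    by rewrite ler_expR growth_bound_le.
  have v0 : (0 <= vol R e (gball e x r))%E by apply: esum_ge0 => y _; rewrite lee_fin.
  rewrite -[leRHS]expeRK -lee_expeR lneK ?expeRK //=.
  by rewrite in_itv /= v0 leey.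
Qed.
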